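(* Let $G_A$ be a $2n$-dimensional almost abelian Lie group with Lie algebra $\mathfrak g_A=\mathbb Re_0\ltimes_A\mathfrak h$. Suppose that $\mathfrak h$ decomposes into $A$-invariant subspaces $\mathfrak h=\mathfrak h_c\oplus\mathfrak h_s$, with $\dim\mathfrak h_c=2k-1$ and $\dim\mathfrak h_s=2(n-k)$, where $1\le k\le n$, and write $A_c=A|_{\mathfrak h_c}$ and $A_s=A|_{\mathfrak h_s}$. Assume that: (i) the quotient Lie algebra $\mathfrak g_c:=\mathfrak g_A/\mathfrak h_s\cong\mathbb Re_0\ltimes_{A_c}\mathfrak h_c$ admits a complex structure; (ii) there exists a closed $2$-form $\omega\in\bigwedge^2\mathfrak g_A^*$ restricting to a non-degenerate form $\sigma\in\bigwedge^2\mathfrak h_s^*$ on the ideal $\mathfrak h_s$. Then $G_A$ admits a left-invariant generalized complex structure of type $k$.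
   Context: Almost abelian Lie groups: $\mathfrak g_A=\mathbb Re_0\ltimes_A\mathfrak h$ is the real Lie algebra with abelian ideal $\mathfrak h\cong\mathbb R^{2n-1}$ of codimension one and bracket $[e_0,v]=Av$ for $v\in\mathfrak h$, where $A$ is the matrix of $\mathrm{ad}_{e_0}|_{\mathfrak h}$; $G_A$ is the simply connected Lie group with Lie algebra $\mathfrak g_A$. A complex structure on a Lie algebra is an integrable one (vanishing Nijenhuis tensor), i.e. a left-invariant complex structure on the corresponding Lie group. The differential on $\bigwedge^\bullet\mathfrak g_A^*$ is the derivation determined by $\mathrm d\xi(X,Y)=-\xi([X,Y])$ for $\xi\in\mathfrak g_A^*$. Left-invariant generalized complex structures: for a Lie group $G$ with Lie algebra $\mathfrak g$ of real dimension $2n$, give $\mathfrak g\oplus\mathfrak g^*$ the pairing $\langle X+\xi,Y+\eta\rangle=\frac12(\xi(Y)+\eta(X))$. A left-invariant generalized complex structure on $G$ is (equivalently) a linear map $\mathcal J$ of $\mathfrak g\oplus\mathfrak g^*$ with $\mathcal J^2=-\mathrm{Id}$, orthogonal for the pairing, whose $\mathbf i$-eigenspace $L\subset(\mathfrak g\oplus\mathfrak g^* )\otimes\mathbb C$ is closed under the Courant bracket on left-invariant sections, $[[X+\xi,Y+\eta]]=[X,Y]+\mathrm{ad}^*_X\eta-\mathrm{ad}^*_Y\xi$, with $(\mathrm{ad}^*_X\eta)(Y)=-\eta([X,Y])$ (extended $\mathbb C$-bilinearly). The space $L$ is the annihilator, for the Clifford action $(X+\xi)\cdot\rho=\iota_X\rho+\xi\wedge\rho$,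 of a unique complex line $K_L\subset\bigwedge^\bullet\mathfrak g^*\otimes\mathbb C$. Any generator $\rho$ of $K_L$ has the form $\rho=\exp(B+\mathbf i\omega)\wedge\Omega$ with $B,\omega\in\bigwedge^2\mathfrak g^*$ real and $\Omega=\theta_1\wedge\cdots\wedge\theta_k$ with linearly independent $\theta_i\in\mathfrak g^*\otimes\mathbb C$ ($\Omega$ a nonzero constant if $k=0$), and satisfies $\omega^{n-k}\wedge\Omega\wedge\overline\Omega\ne0$. The integer $k\in\{0,\dots,n\}$ is the type of $\mathcal J$. *)

(* Defs.v *)
From HB Require Import structures.
From mathcomp Require Import all_boot all_order all_algebra.
From mathcomp Require Import generic_quotient ring_quotient.
From mathcomp Require Import complex.
From mathcomp Require Import reals.

Set Implicit Arguments.
Unset Strict Implicit.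
Unset Printing Implicit Defensive.

Import GRing.Theory.
Local Open Scope ring_scope.
Local Open Scope quotient_scope.

(* Exterior algebra of the dual of F^N.  An element is the family of its
   coordinates in the basis e^I = e^{i_1} /\ ... /\ e^{i_p}, where
   I = {i_1 < ... < i_p} and (e^i) is the basis dual to the standard one.
   Covectors, like vectors, are columns of coordinates. *)
Definition ext (F : fieldType) (N : nat) := {ffun {set 'I_N} -> F^o}.

HB.instance Definition _ (F : fieldType) (N : nat) :=
  GRing.Lmodule.copy (ext F N) {ffun {set 'I_N} -> F^o}.

Section ExteriorAlgebra.
Variables (F : fieldType) (N : nat).
Implicit Types (phi psi : ext F N) (I J K : {set 'I_N}) (X Y xi : 'cV[F]_N).

Definition ext_basis I : ext F N := [ffun K => (K == I)%:R].

Definition ext_one : ext F N := ext_basis set0.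

(* For disjoint I and J, e^I /\ e^J = shuffle_sign I J * e^(I U J). *)
Definition shuffle_sign I J : F :=
  (-1) ^+ #|[set p : 'I_N * 'I_N
              | [&& p.1 \in I, p.2 \in J & (p.2 < p.1)%N]]|.

Definition wedge phi psi : ext F N :=
  [ffun K : {set 'I_N} => \sum_(I in powerset K)
     shuffle_sign I (K :\: I) * (phi I * psi (K :\: I))].

Definition wedge_pow phi (j : nat) : ext F N := iter j (wedge phi) ext_one.

(* The truncation loses nothing when phi has no component of degree 0, since
   then phi^j = 0 for j > N. *)
Definition wedge_exp phi : ext F N :=
  \sum_(j < N.+1) (j`!%:R : F)^-1 *: wedge_pow phi j.

Definition covector xi : ext F N := \sum_i xi i 0 *: ext_basis [set i].

(* Interior product: the coordinate on e^I of the contraction by e_i of phi is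
   phi(e_i, e_{i_1}, ..., e_{i_p}), which is the coordinate of phi on
   e^({i} U I) up to the sign of the permutation moving i to its place. *)
Definition contract X phi : ext F N :=
  [ffun I : {set 'I_N} => \sum_(i | i \notin I)
     (-1) ^+ #|[set j in I | (j < i)%N]| * (X i 0 * phi (i |: I))].

Definition homogeneous (p : nat) phi : Prop :=
  forall I, phi I != 0 -> #|I| = p.

Definition eval2 phi X Y : F := contract Y (contract X phi) set0.

Definition nondegenerate_on phi (U : {pred 'cV[F]_N}) : Prop :=
  forall X, X \in U -> (forall Y, Y \in U -> eval2 phi X Y = 0) -> X = 0.

Definition stdvec (i : 'I_N) : 'cV[F]_N := delta_mx i 0.

(* d e^i, the 2-form (X, Y) |-> - e^i([X, Y]). *)
Definition d_dual_basis (br : 'cV[F]_N -> 'cV[F]_N -> 'cV[F]_N) (i : 'I_N) :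
    ext F N :=
  \sum_(j < N) \sum_(l < N | (j < l)%N)
    (- br (stdvec j) (stdvec l) i 0) *: ext_basis [set j; l].

(* The antiderivation of degree 1 taking the values d_dual_basis br i on the
   generators e^i. *)
Definition ext_d (br : 'cV[F]_N -> 'cV[F]_N -> 'cV[F]_N) phi : ext F N :=
  \sum_i wedge (d_dual_basis br i) (contract (stdvec i) phi).

(* V (+) V^* for V = F^N: upper half the vector, lower half the covector. *)
Definition pairing (u v : 'cV[F]_(N + N)) : F :=
  2%:R^-1 * \sum_i (dsubmx u i 0 * usubmx v i 0 + dsubmx v i 0 * usubmx u i 0).

Definition clifford (u : 'cV[F]_(N + N)) phi : ext F N :=
  contract (usubmx u) phi + wedge (covector (dsubmx u)) phi.

(* The covector Y |-> - eta([X, Y]). *)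
Definition ad_star (br : 'cV[F]_N -> 'cV[F]_N -> 'cV[F]_N) X (eta : 'cV[F]_N) :
    'cV[F]_N :=
  \col_i - \sum_l eta l 0 * br X (stdvec i) l 0.

Definition courant (br : 'cV[F]_N -> 'cV[F]_N -> 'cV[F]_N)
    (u v : 'cV[F]_(N + N)) : 'cV[F]_(N + N) :=
  col_mx (br (usubmx u) (usubmx v))
         (ad_star br (usubmx u) (dsubmx v) - ad_star br (usubmx v) (dsubmx u)).

End ExteriorAlgebra.

Arguments ext_one {F N}.
Arguments stdvec {F N}.

Section AlmostAbelian.
Variables (F : fieldType) (m : nat).

(* R e_0 |x_A F^m, carried by F^(1 + m) with e_0 as first basis vector:
   [a e_0 + v, b e_0 + w] = a A w - b A v. *)
Definition aa_bracket (A : 'M[F]_m) (X Y : 'cV[F]_(1 + m)) : 'cV[F]_(1 + m) :=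
  col_mx 0 (X 0 0 *: (A *m dsubmx Y) - Y 0 0 *: (A *m dsubmx X)).

(* The image in F^(1 + m) of a subspace of the ideal F^m, i.e. its image under
   v |-> col_mx 0 v. *)
Definition aa_ideal (U : {vspace 'cV[F]_m}) : {vspace 'cV[F]_(1 + m)} :=
  (linfun (mulmx (col_mx 0 1%:M : 'M[F]_(1 + m, m))) @: U)%VS.

End AlmostAbelian.

(* The library only makes the quotient of a module an abelian group. *)
Section QuotientModule.
Variables (F : fieldType) (V : vectType F) (U : {vspace V}).

Definition vquot := Quotient.quot U.

HB.instance Definition _ := GRing.Zmodule.on vquot.
HB.instance Definition _ := EqQuotient.on vquot.

Definition vquot_scale (a : F) (x : vquot) : vquot := \pi_vquot (a *: repr x).

Lemma vquot_eqE (x y : V) :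
  (\pi_vquot x == \pi_vquot y :> vquot) = (x - y \in U).
Proof. by rewrite Quotient.idealrBE. Qed.

Lemma vquot_piD (x y : V) :
  \pi_vquot (x + y) = \pi_vquot x + \pi_vquot y :> vquot.
Proof. exact: (@pi_addr _ _ _ _ _ (Quotient.quot U)). Qed.

Lemma vquot_reprK (x : V) : x - repr (\pi_vquot x) \in U.
Proof. by rewrite -vquot_eqE reprK. Qed.

Lemma vquot_piZ (a : F) (x : V) :
  \pi_vquot (a *: x) = vquot_scale a (\pi_vquot x).
Proof.
apply/eqP; rewrite /vquot_scale vquot_eqE -scalerBr.
by rewrite memvZ ?vquot_reprK.
Qed.

Lemma vquot_surj (x : vquot) : exists y, x = \pi_vquot y.
Proof. by exists (repr x); rewrite reprK. Qed.

Fact vquot_scaleA a b (x : vquot) :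
  vquot_scale a (vquot_scale b x) = vquot_scale (a * b) x.
Proof.
by have [y ->] := vquot_surj x; rewrite -!vquot_piZ scalerA.
Qed.

Fact vquot_scale1 : left_id 1 vquot_scale.
Proof. by move=> x; have [y ->] := vquot_surj x; rewrite -vquot_piZ scale1r. Qed.

Fact vquot_scaleDr : right_distributive vquot_scale +%R.
Proof.
move=> a x y; have [[u ->] [v ->]] := (vquot_surj x, vquot_surj y).
rewrite -vquot_piD -!vquot_piZ scalerDr.
exact: vquot_piD.
Qed.

Fact vquot_scaleDl x : {morph vquot_scale^~ x : a b / a + b}.
Proof.
move=> a b; have [y ->] := vquot_surj x; rewrite -!vquot_piZ scalerDl; exact: vquot_piD.
Qed.

HB.instance Definition _ := GRing.Zmodule_isLmodule.Build F vquot
  vquot_scaleA vquot_scale1 vquot_scaleDr vquot_scaleDl.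

(* Independent of the representatives when U is an ideal: see pi_aa_bracket. *)
Definition vquot_bracket (br : V -> V -> V) (x y : vquot) : vquot :=
  \pi_vquot (br (repr x) (repr y)).

End QuotientModule.

Arguments vquot {F V}.
Arguments vquot_bracket {F V}.

Section QuotientBracket.
Variables (F : fieldType) (m : nat) (A : 'M[F]_m) (U : {vspace 'cV[F]_m}).
Hypothesis AU : forall v, v \in U -> A *m v \in U.

Lemma aa_idealP (X : 'cV[F]_(1 + m)) :
  reflect (exists2 v, v \in U & X = col_mx 0 v) (X \in aa_ideal U).
Proof.
apply: (iffP memv_imgP) => -[v vU ->]; exists v => //;
  by rewrite lfunE /= mul_col_mx mul0mx mul1mx.
Qed.

Lemma aa_bracket_ideal X Z : Z \in aa_ideal U -> aa_bracket A X Z \in aa_ideal U.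
Proof.
case/aa_idealP=> v vU ->; apply/aa_idealP.
exists (X 0 0 *: (A *m v)); first by rewrite memvZ ?AU.
rewrite /aa_bracket col_mxKd.
have -> : (col_mx 0 v : 'cV[F]_(1 + m)) 0 0 = 0.
  by rewrite mxE; case: splitP => // j _; rewrite mxE.
by rewrite scale0r subr0.
Qed.

Lemma aa_bracketC X Y : aa_bracket A X Y = - aa_bracket A Y X.
Proof. by rewrite /aa_bracket opp_col_mx oppr0 opprB. Qed.

Lemma aa_bracketBr X Y Z :
  aa_bracket A X (Y - Z) = aa_bracket A X Y - aa_bracket A X Z.
Proof.
rewrite /aa_bracket opp_col_mx add_col_mx oppr0 addr0 linearB /= mulmxBr.
rewrite !mxE scalerBr scalerBl; congr (col_mx _ _).
by rewrite !opprD !opprK addrACA.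
Qed.

Lemma pi_aa_bracket X Y :
  \pi_(vquot (aa_ideal U)) (aa_bracket A X Y) =
  vquot_bracket (aa_ideal U) (aa_bracket A) (\pi X) (\pi Y).
Proof.
apply/eqP; rewrite vquot_eqE.
set x := repr _; set y := repr _.
rewrite (_ : _ - _ = aa_bracket A X (Y - y) - aa_bracket A y (X - x)).
  by rewrite rpredB // aa_bracket_ideal // vquot_reprK.
rewrite !aa_bracketBr (aa_bracketC y X) (aa_bracketC y x).
by rewrite opprD !opprK addrA subrK.
Qed.

End QuotientBracket.

(* An integrable almost complex structure on the Lie algebra (L, br). *)
Definition is_complex_structure (F : fieldType) (L : lmodType F)
    (br : L -> L -> L) (J : {linear L -> L}) : Prop :=
  (forall x, J (J x) = - x) /\
  (forall x y, br (J x) (J y) - J (br (J x) y) - J (br x (J y)) - br x y = 0).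

Section Generalized.
Variables (R : realType) (N : nat).
Implicit Types (br : 'cV[R]_N -> 'cV[R]_N -> 'cV[R]_N).

Definition to_complex (p q : nat) (M : 'M[R]_(p, q)) : 'M[R[i]]_(p, q) :=
  map_mx (real_complex R) M.

(* The C-bilinear extension of br. *)
Definition complexify_bracket br (X Y : 'cV[R[i]]_N) : 'cV[R[i]]_N :=
  let X1 := map_mx (@complex.Re R) X in let X2 := map_mx (@complex.Im R) X in
  let Y1 := map_mx (@complex.Re R) Y in let Y2 := map_mx (@complex.Im R) Y in
  to_complex (br X1 Y1 - br X2 Y2)
  + 'i%C *: to_complex (br X1 Y2 + br X2 Y1).

Definition complexify_form (phi : ext R N) : ext R[i] N :=
  [ffun I => real_complex R (phi I)].

Definition conj_form (phi : ext R[i] N) : ext R[i] N :=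
  [ffun I => conjc (phi I)].

Definition closed_2form br (omega : ext R N) : Prop :=
  homogeneous 2 omega /\ ext_d br omega = 0.

Definition i_eigenspace (J : 'M[R]_(N + N)) : {pred 'cV[R[i]]_(N + N)} :=
  [pred u | to_complex J *m u == 'i%C *: u].

(* J acts on V (+) V^*, V = R^N, N even, and br is the Lie bracket of V. *)
Definition is_generalized_complex br (J : 'M[R]_(N + N)) : Prop :=
  [/\ J *m J = - 1%:M,
      forall u v, pairing (J *m u) (J *m v) = pairing u v
    & forall u v, u \in i_eigenspace J -> v \in i_eigenspace J ->
        courant (complexify_bracket br) u v \in i_eigenspace J].

(* rho generates the line K_L whose annihilator is L. *)
Definition is_pure_spinor (J : 'M[R]_(N + N)) (rho : ext R[i] N) : Prop :=
  rho != 0 /\ forall u, (u \in i_eigenspace J) = (clifford u rho == 0).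

(* Omega = c theta_1 /\ ... /\ theta_k; for k > 0 the constant c can be
   absorbed in theta_1.  With dim V = 2n, N./2 - k is n - k. *)
Definition has_type (J : 'M[R]_(N + N)) (k : nat) : Prop :=
  exists rho : ext R[i] N, is_pure_spinor J rho /\
  exists (B omega : ext R N) (c : R[i]) (theta : k.-tuple 'cV[R[i]]_N),
    let Omega := c *: \big[@wedge _ N/ext_one]_(t <- theta) covector t in
    [/\ [/\ homogeneous 2 B, homogeneous 2 omega, c != 0 & free theta],
        rho = wedge (wedge_exp (complexify_form B
                                + 'i%C *: complexify_form omega)) Omega
      & wedge (wedge_pow (complexify_form omega) (N./2 - k))
              (wedge Omega (conj_form Omega)) != 0].

End Generalized.

(* Main.v *)
Require Import Defs.
From HB Require Import structures.
From mathcomp Require Import all_boot all_order all_algebra.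
From mathcomp Require Import generic_quotient.
From mathcomp Require Import complex.
From mathcomp Require Import reals.
From mathcomp Require Import ring zify.

Set Implicit Arguments.
Unset Strict Implicit.
Unset Printing Implicit Defensive.

Import GRing.Theory Num.Theory.
Local Open Scope ring_scope.

(** Let W be the sum of the line R e_0 and h_c, and let U be the ideal given by
    h_s.  As h_c is A-invariant, W is a subalgebra complementing U, and the
    projection P onto W along U commutes with ad e_0; it is a Lie algebra
    endomorphism.  A complex structure on the quotient by U thus becomes an
    operator J with P J = J P = J and J^2 = - P, whose Nijenhuis tensor, with P
    in place of the identity, vanishes (complex_structure_lift).

    Closedness of omega says, on pairs of vectors of h, that ad e_0 is
    infinitesimally symplectic for omega.  This property only concerns omega on
    h and passes to the form S that agrees with omega on U and vanishes on W
    (cut_form_invariant).  The sought structure is the direct sum of the complex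
    structure J on W and of the symplectic structure S on U: its matrix is
    gc_mx, with a bivector be that inverts - S on U (symplectic_inverse).

    Its i-eigenspace L consists of the X + xi such that the W-part of X is of
    type (1,0), the W-part of xi is of type (0,1), and the U-part of xi is
    - i times the contraction of S by X (gc_eigenP).  Closure of L under the
    Courant bracket then follows from the vanishing of the Nijenhuis tensor and
    from the invariance of S (courant_eigenspace).

    The spinor is rho = exp(i S) /\ Theta, Theta = theta_1 /\ ... /\ theta_k, where
    the theta_j form a basis of the covectors of type (0,1) on W.  Contracting
    exp(i S) by X multiplies it by i iota_X S, so L kills rho.  Conversely, by
    the Clifford relation whatever kills rho is orthogonal to L, and L is its
    own orthogonal because the structure is orthogonal with square - 1
    (eigen_iff_clifford0).

    Finally, S^(n - k) /\ Theta /\ conj Theta is a nonzero form of top degree.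
    If S^j /\ psi = 0 with j > 0 minimal and psi = Theta /\ conj Theta, then
    contracting by the vectors of U shows that the covectors vanishing on W kill
    the nonzero form S^(j - 1) /\ psi; those vanishing on U already kill psi.  So
    all covectors kill it and it has top degree: j - 1 = n - k
    (two_form_pow_wedge_neq0).  That psi itself is nonzero comes from the
    independence of the theta_j and their conjugates, which span the two
    eigenspaces of the transpose of J in the image of P^T (free_thetas_cat). *)

(** * The exterior algebra *)

Section Wedge.
Variables (F : fieldType) (N : nat).
Implicit Types (phi psi chi : ext F N) (I J K : {set 'I_N}).
Implicit Types (X Y a b : 'cV[F]_N).

Lemma wedge_is_linear phi : linear (wedge phi).
Proof.
move=> c psi chi; apply/ffunP=> K; rewrite !ffunE /= scaler_sumr -big_split /=.
apply: eq_bigr => I _; rewrite !ffunE /= /GRing.scale /=.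
ring.
Qed.

HB.instance Definition _ phi :=
  GRing.isLinear.Build F (ext F N) (ext F N) *:%R (wedge phi)
    (wedge_is_linear phi).

(** Right multiplication as a function of its last argument, so that the theory
    of linear maps applies to the left factor of a wedge product. *)
Definition wedger psi phi := wedge phi psi.

Lemma wedger_is_linear psi : linear (wedger psi).
Proof.
move=> c phi chi; apply/ffunP=> K; rewrite !ffunE /= scaler_sumr -big_split /=.
apply: eq_bigr => I _; rewrite !ffunE /= /GRing.scale /=.
ring.
Qed.

HB.instance Definition _ psi :=
  GRing.isLinear.Build F (ext F N) (ext F N) *:%R (wedger psi)
    (wedger_is_linear psi).

Lemma wedgeDl phi psi chi : wedge (phi + psi) chi = wedge phi chi + wedge psi chi.
Proof. exact: (linearD (wedger chi)). Qed.

Lemma wedgeZl c phi chi : wedge (c *: phi) chi = c *: wedge phi chi.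
Proof. exact: (linearZ_LR (wedger chi)). Qed.

Lemma wedgeNl phi chi : wedge (- phi) chi = - wedge phi chi.
Proof. exact: (linearN (wedger chi)). Qed.

Lemma wedge0l chi : wedge 0 chi = 0.
Proof. exact: (linear0 (wedger chi)). Qed.

Lemma wedge_suml (T : Type) (r : seq T) (P : pred T) (E : T -> ext F N) chi :
  wedge (\sum_(i <- r | P i) E i) chi = \sum_(i <- r | P i) wedge (E i) chi.
Proof. exact: (linear_sum (wedger chi)). Qed.

Lemma contract_is_linear X : linear (contract X : ext F N -> ext F N).
Proof.
move=> c psi chi; apply/ffunP=> K; rewrite !ffunE /= scaler_sumr -big_split /=.
apply: eq_bigr => I _; rewrite !ffunE /= /GRing.scale /=.
ring.
Qed.

HB.instance Definition _ X :=
  GRing.isLinear.Build F (ext F N) (ext F N) *:%R (contract X)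
    (contract_is_linear X).

Lemma covector_is_linear : linear (@covector F N).
Proof.
move=> c a b; rewrite /covector scaler_sumr -big_split /=.
by apply: eq_bigr => i _; rewrite !mxE scalerDl scalerA.
Qed.

HB.instance Definition _ :=
  GRing.isLinear.Build F 'cV[F]_N (ext F N) *:%R (@covector F N)
    covector_is_linear.

Lemma ext_expand phi : phi = \sum_I phi I *: ext_basis F I.
Proof.
apply/ffunP=> K; rewrite sum_ffunE (bigD1 K) //= !ffunE eqxx /GRing.scale /= mulr1.
rewrite big1 ?addr0 // => I neqIK; rewrite !ffunE eq_sym (negPf neqIK).
by rewrite /GRing.scale /= mulr0.
Qed.

Lemma ext_basis_wedge I J :
  wedge (ext_basis F I) (ext_basis F J) =
    ([disjoint I & J]%:R * shuffle_sign F I J) *: ext_basis F (I :|: J).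
Proof.
apply/ffunP=> K; rewrite !ffunE /GRing.scale /=.
case: (boolP [disjoint I & J]) => dIJ; last first.
  rewrite mul0r mul0r big1 // => L; rewrite powersetE => sLK; rewrite !ffunE.
  case: (altP (L =P I)) => [eLI|]; last by rewrite mul0r mulr0.
  case: (altP (K :\: L =P J)) => [eJ|]; last by rewrite mulr0 mulr0.
  by case/negP: dIJ; rewrite -eLI -eJ disjoint_sym disjoints_subset setDE subsetIr.
rewrite mul1r; case: (altP (K =P I :|: J)) => [->|nK]; last first.
  rewrite mulr0 big1 // => L; rewrite powersetE => sLK; rewrite !ffunE.
  case: (altP (L =P I)) => [eLI|]; last by rewrite mul0r mulr0.
  case: (altP (K :\: L =P J)) => [eJ|]; last by rewrite mulr0 mulr0.
  by case/eqP: nK; rewrite -eLI -eJ -{1}(setID K L) (setIidPr sLK).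
have eD : (I :|: J) :\: I = J.
  rewrite setDUl setDv set0U; apply/setDidPl; by rewrite disjoint_sym.
rewrite (bigD1 I) /=; last by rewrite powersetE subsetUl.
rewrite !ffunE !eqxx eD eqxx !mulr1 big1 ?addr0 // => L /andP[_ nLI].
by rewrite !ffunE (negPf nLI) mul0r mulr0.
Qed.

(** The sign counts inversions between the two index sets, hence it is
    multiplicative in each of them; this is all that associativity needs. *)
Lemma shuffle_signUl I J K : [disjoint I & J] ->
  shuffle_sign F (I :|: J) K = shuffle_sign F I K * shuffle_sign F J K.
Proof.
move=> dIJ; rewrite /shuffle_sign -exprD; congr (_ ^+ _).
rewrite -cardsUI -[LHS]addn0; congr (_ + _)%N.
  by apply: eq_card => -[i j]; rewrite !inE /=; case: (i \in I); case: (i \in J);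
     case: (j \in K); case: (j < i)%N.
symmetry; apply/eqP; rewrite cards_eq0; apply/eqP/setP => -[i j]; rewrite !inE /=.
by case: (boolP (i \in I)) => //= iI; rewrite (disjointFr dIJ iI) andbF.
Qed.

Lemma shuffle_signUr I J K : [disjoint J & K] ->
  shuffle_sign F I (J :|: K) = shuffle_sign F I J * shuffle_sign F I K.
Proof.
move=> dJK; rewrite /shuffle_sign -exprD; congr (_ ^+ _).
rewrite -cardsUI -[LHS]addn0; congr (_ + _)%N.
  by apply: eq_card => -[i j]; rewrite !inE /=; case: (i \in I);
     case: (j \in J); case: (j \in K);
     case: (j < i)%N.
symmetry; apply/eqP; rewrite cards_eq0; apply/eqP/setP => -[i j]; rewrite !inE /=.
by case: (boolP (j \in J)) => //= jJ; rewrite ?(disjointFr dJK jJ) /= ?andbF.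
Qed.

Lemma ext_basis_wedgeA I J K :
  wedge (ext_basis F I) (wedge (ext_basis F J) (ext_basis F K)) =
  wedge (wedge (ext_basis F I) (ext_basis F J)) (ext_basis F K).
Proof.
rewrite !ext_basis_wedge linearZ /= wedgeZl !ext_basis_wedge !scalerA setUA.
congr (_ *: _).
have -> : [disjoint I & J :|: K] = [disjoint I & J] && [disjoint I & K].
  by rewrite ![[disjoint I & _]]disjoint_sym !disjoints_subset subUset.
have -> : [disjoint I :|: J & K] = [disjoint I & K] && [disjoint J & K].
  by rewrite !disjoints_subset subUset.
case: (boolP [disjoint J & K]) => dJK; last by rewrite andbF !mul0r mulr0.
case: (boolP [disjoint I & J]) => dIJ; last by rewrite !mul0r mulr0.
rewrite shuffle_signUl // shuffle_signUr //= andbT; move: (_ %:R) => e.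
ring.
Qed.

Lemma ext_linear_eq (f g : {linear ext F N -> ext F N}) :
  (forall I, f (ext_basis F I) = g (ext_basis F I)) -> f =1 g.
Proof.
move=> fg phi; rewrite [phi]ext_expand !linear_sum; apply: eq_bigr => I _.
by rewrite !linearZ fg.
Qed.

Lemma wedgeA phi psi chi :
  wedge phi (wedge psi chi) = wedge (wedge phi psi) chi.
Proof.
apply: (ext_linear_eq (f := wedger (wedge psi chi))
          (g := wedger chi \o wedger psi)) phi => I.
apply: (ext_linear_eq (f := wedge (ext_basis F I) \o wedger chi)
          (g := wedger chi \o wedge (ext_basis F I))) psi => J.
apply: (ext_linear_eq (f := wedge (ext_basis F I) \o wedge (ext_basis F J))
          (g := wedge (wedge (ext_basis F I) (ext_basis F J)))) chi => K.
exact: ext_basis_wedgeA.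
Qed.

Lemma shuffle_sign0l J : shuffle_sign F set0 J = 1.
Proof.
rewrite /shuffle_sign (_ : [set _ | _] = set0) ?cards0 //.
by apply/setP=> p; rewrite !inE.
Qed.

Lemma wedge1l phi : wedge ext_one phi = phi.
Proof.
apply/ffunP=> K; rewrite !ffunE (bigD1 set0) /=; last first.
  by rewrite powersetE sub0set.
rewrite ffunE eqxx setD0 shuffle_sign0l !mul1r big1 ?addr0 // => I /andP[_ nI].
by rewrite ffunE (negPf nI) mul0r mulr0.
Qed.

(** The sign of the shuffle moving i to its place in I, common to the contraction
    by e_i and to the left multiplication by e^i. *)
Definition position_sign (i : 'I_N) I : F := (-1) ^+ #|[set j in I | (j < i)%N]|.

Lemma position_signU1 i j I : j \notin I ->
  position_sign i (j |: I) = (-1) ^+ (j < i)%N * position_sign i I.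
Proof.
move=> nj; rewrite /position_sign -exprD; congr (_ ^+ _).
case: (boolP (j < i)%N) => ji; last first.
  apply: eq_card => l; rewrite !inE; case: eqP => [->|//].
  by rewrite (negPf ji) !andbF.
rewrite (_ : [set _ | _] = j |: [set j in I | (j < i)%N]).
  by rewrite cardsU1 !inE (negPf nj).
by apply/setP=> l; rewrite !inE; case: eqP => [->|].
Qed.

Lemma position_signU1_id i I : position_sign i (i |: I) = position_sign i I.
Proof.
rewrite /position_sign; congr (_ ^+ _); apply: eq_card => l; rewrite !inE.
by case: eqP => [->|//]; rewrite ltnn !andbF.
Qed.

Lemma position_signK i I : position_sign i I * position_sign i I = 1.
Proof. by rewrite /position_sign -expr2 sqrr_sign. Qed.

Lemma contractE X phi I :
  contract X phi I =
    \sum_(i | i \notin I) position_sign i I * (X i 0 * phi (i |: I)).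
Proof. by rewrite ffunE. Qed.

Lemma wedge_covectorE a phi K :
  wedge (covector a) phi K =
    \sum_(i in K) position_sign i K * (a i 0 * phi (K :\ i)).
Proof.
rewrite /covector wedge_suml sum_ffunE big_mkcond [RHS]big_mkcond.
apply: eq_bigr => i _; rewrite wedgeZl !ffunE /GRing.scale /=.
case: ifP => iK; last first.
  rewrite big1 ?mulr0 // => I; rewrite powersetE => sIK; rewrite ffunE.
  by case: eqP sIK => [->|]; rewrite ?mul0r ?mulr0 // sub1set iK.
rewrite (bigD1 [set i]) /=; last by rewrite powersetE sub1set.
rewrite ffunE eqxx mul1r big1 ?addr0; last first.
  by move=> I /andP[_ nI]; rewrite ffunE (negPf nI) mul0r mulr0.
rewrite mulrCA; congr (_ * _); rewrite /shuffle_sign /position_sign.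
congr (_ ^+ _).
have pairI : injective (pair i : 'I_N -> 'I_N * 'I_N) by move=> j l [].
rewrite -(card_imset _ pairI); apply: eq_card => -[j l]; rewrite !inE /=.
apply/idP/imsetP => [/and3P[/eqP-> /andP[nli lK] lti]|].
  by exists l; rewrite // inE lK.
case=> l'; rewrite inE => /andP[lK lti] [-> ->]; rewrite eqxx lK lti !andbT.
by apply: contraTneq lti => ->; rewrite ltnn.
Qed.

Definition coval (a X : 'cV[F]_N) : F := \sum_i a i 0 * X i 0.

Lemma sum_setD1_in (I : {set 'I_N}) (j : 'I_N) (E : 'I_N -> F) : j \in I ->
  \sum_(i | i \notin I :\ j) E i = E j + \sum_(i | i \notin I) E i.
Proof.
move=> jI; rewrite (bigD1 j) /= ?setD11 //; congr (_ + _); apply: eq_bigl => i.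
by rewrite in_setD1 negb_and negbK; case: eqP => [->|]; rewrite ?jI ?andbF ?andbT.
Qed.

Lemma extDE phi psi I : (phi + psi) I = phi I + psi I.
Proof. by rewrite [LHS]ffunE. Qed.

Lemma extNE phi I : (- phi) I = - phi I.
Proof. by rewrite [LHS]ffunE. Qed.

Lemma extZE c phi I : (c *: phi) I = c * phi I.
Proof. by rewrite [LHS]ffunE. Qed.

Lemma contractDl X Y phi : contract (X + Y) phi = contract X phi + contract Y phi.
Proof.
apply/ffunP => I; rewrite extDE !contractE -big_split; apply: eq_bigr => i _.
rewrite mxE /=; ring.
Qed.

Lemma contractZl c X phi : contract (c *: X) phi = c *: contract X phi.
Proof.
apply/ffunP => I; rewrite extZE !contractE mulr_sumr; apply: eq_bigr => i _.
rewrite mxE; ring.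
Qed.

Lemma contract0l phi : contract 0 phi = 0.
Proof. by rewrite -(scale0r 0) contractZl scale0r. Qed.

(** Contraction is an antiderivation.  The terms that insert i and remove j from
    the index set cancel between both sides, because exchanging the order of the
    insertion and of the removal changes the sign; the terms inserting and
    removing the same index give a(X). *)
Lemma contract_wedge_covector X a phi :
  contract X (wedge (covector a) phi) =
    coval a X *: phi - wedge (covector a) (contract X phi).
Proof.
apply/ffunP=> I; rewrite extDE extNE extZE contractE wedge_covectorE.
pose T i j := position_sign i I * X i 0 *
  (position_sign j (i |: I) * (a j 0 * phi ((i |: I) :\ j))).
(* Here the terms inserting i and removing it again give the part of a(X) phi(I)
   with i outside I; the part with i in I comes from the right-hand side. *)
transitivity (\sum_(i | i \notin I) (a i 0 * X i 0 * phi I)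
              + \sum_(i | i \notin I) \sum_(j in I) T i j).
  rewrite -big_split; apply: eq_bigr => i niI /=.
  rewrite wedge_covectorE big_setU1 //= mulrDr mulrDr; congr (_ + _).
    rewrite position_signU1_id setU1K //.
    rewrite -[RHS]mul1r -(position_signK i I); ring.
  by rewrite !mulr_sumr; apply: eq_bigr => j jI; rewrite /T; ring.
transitivity (coval a X * phi I - (\sum_(j in I) (a j 0 * X j 0 * phi I)
              - \sum_(j in I) \sum_(i | i \notin I) T i j)).
  have -> : coval a X * phi I = \sum_(j in I) (a j 0 * X j 0 * phi I)
      + \sum_(i | i \notin I) (a i 0 * X i 0 * phi I).
    by rewrite /coval mulr_suml (bigID (mem I)).
  by rewrite exchange_big /=; ring.
congr (_ - _); rewrite -sumrB; apply: eq_bigr => j jI.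
rewrite contractE sum_setD1_in // setD1K //.
rewrite 2!mulrDr; congr (_ + _).
  have := position_signU1_id j (I :\ j); rewrite setD1K // => <-.
  rewrite -[LHS]mul1r -(position_signK j I); ring.
rewrite -sumrN !mulr_sumr; apply: eq_bigr => i niI; rewrite /T.
have neq_ij : i != j by apply: contraNneq niI => ->.
have -> : (i |: I) :\ j = i |: (I :\ j).
  by rewrite setDUl; congr (_ :|: _); apply/setDidPl; rewrite disjoints1 inE.
have := position_signU1 i (negbT (setD11 j I)); rewrite setD1K // => ->.
rewrite position_signU1 //.
have : (-1) ^+ (j < i)%N = - (-1) ^+ (i < j)%N :> F.
  by case: ltngtP neq_ij => //= [|/val_inj->]; rewrite ?opprK ?eqxx.
move=> ->; have : (-1) ^+ (i < j)%N * (-1) ^+ (i < j)%N = 1 :> F.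
  by rewrite -expr2 sqrr_sign.
move: ((-1) ^+ _ : F) => e ee; rewrite -[RHS]mul1r -ee; ring.
Qed.

Lemma position_sign_swap i j I : i \notin I -> j \notin I -> i != j ->
  position_sign i I * position_sign j (i |: I) =
    - (position_sign j I * position_sign i (j |: I)).
Proof.
move=> niI njI neq_ij; rewrite !position_signU1 //.
have -> : (-1) ^+ (j < i)%N = - (-1) ^+ (i < j)%N :> F.
  by case: ltngtP neq_ij => //= [|/val_inj->]; rewrite ?opprK ?eqxx.
ring.
Qed.

Lemma contract_anticomm X Y phi :
  contract X (contract Y phi) = - contract Y (contract X phi).
Proof.
have contract2E Z W I : contract Z (contract W phi) I =
    \sum_i \sum_j if [&& i \notin I, j \notin I & i != j] then
      position_sign i I * position_sign j (i |: I) * (Z i 0 * W j 0)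
        * phi (i |: (j |: I)) else 0.
  rewrite contractE big_mkcond; apply: eq_bigr => i _.
  case: ifP => niI /=; last by rewrite big1.
  rewrite contractE -big_mkcond /= !mulr_sumr; apply: eq_big => [j|j _].
    by rewrite !inE negb_or andbC [j == i]eq_sym.
  rewrite setUCA; ring.
apply/ffunP=> I; rewrite extNE !contract2E exchange_big -sumrN /=.
apply: eq_bigr => i _; rewrite -sumrN; apply: eq_bigr => j _.
rewrite [j == i]eq_sym andbCA; case: ifP => [/and3P[niI njI neq_ij]|]; last first.
  by rewrite oppr0.
rewrite setUCA position_sign_swap //; last by rewrite eq_sym.
ring.
Qed.

Lemma ext_basis1_anticomm (i j : 'I_N) :
  wedge (ext_basis F [set i]) (ext_basis F [set j]) =
    - wedge (ext_basis F [set j]) (ext_basis F [set i]).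
Proof.
have sgn k l : shuffle_sign F [set k] [set l] = (-1) ^+ (l < k)%N.
  rewrite /shuffle_sign; congr (_ ^+ _); case: (boolP (l < k)%N) => lk.
    rewrite (_ : [set _ | _] = [set (k, l)]) ?cards1 //.
    apply/setP=> -[a b]; rewrite !inE /= xpair_eqE.
    by case: eqP => //= ->; case: eqP => //= ->.
  rewrite (_ : [set _ | _] = set0) ?cards0 //.
  apply/setP=> -[a b]; rewrite !inE /=.
  by case: eqP => //= ->; case: eqP => //= ->; rewrite (negPf lk).
rewrite !ext_basis_wedge !sgn setUC -scaleNr; congr (_ *: _).
rewrite !disjoints1 !inE eq_sym -mulrN.
case: eqP => [->|/eqP ne]; first by rewrite !mul0r.
by case: ltngtP ne => //= h; rewrite ?opprK // (val_inj h) eqxx.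
Qed.

Lemma covector_anticomm a b :
  wedge (covector a) (covector b) = - wedge (covector b) (covector a).
Proof.
rewrite {1 4}/covector wedge_suml linear_sum -sumrN; apply: eq_bigr => i _.
rewrite wedgeZl linearZ /= -scalerN; congr (_ *: _).
rewrite /covector wedge_suml linear_sum -sumrN; apply: eq_bigr => j _.
by rewrite wedgeZl linearZ /= -scalerN ext_basis1_anticomm.
Qed.

Lemma wedge_covectorC a b phi :
  wedge (covector a) (wedge (covector b) phi) =
    - wedge (covector b) (wedge (covector a) phi).
Proof. by rewrite wedgeA covector_anticomm wedgeNl -wedgeA. Qed.

(** The scalar is twice the pairing of u and v: if both kill the same nonzero
    form, they are orthogonal. *)
Lemma clifford_relation (u v : 'cV[F]_(N + N)) phi :
  clifford u (clifford v phi) + clifford v (clifford u phi) =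
    (\sum_i (dsubmx u i 0 * usubmx v i 0 + dsubmx v i 0 * usubmx u i 0)) *: phi.
Proof.
rewrite /clifford !linearD /= !contract_wedge_covector.
rewrite (contract_anticomm (usubmx v)) wedge_covectorC.
rewrite big_split /= scalerDl -!/(coval _ _) addrACA.
by apply/ffunP=> I; rewrite !(extDE, extNE, extZE); ring.
Qed.

Lemma homogeneousP p phi :
  homogeneous p phi <-> (forall I, #|I| != p -> phi I = 0).
Proof.
split=> h I; first by move=> /eqP nI; apply/eqP; apply: contra_notT nI => /h.
by move=> /eqP nz; apply/eqP; apply: contra_notT nz => /h.
Qed.

Lemma homogeneousD p phi psi :
  homogeneous p phi -> homogeneous p psi -> homogeneous p (phi + psi).
Proof.
move=> /homogeneousP h1 /homogeneousP h2; apply/homogeneousP => I nI.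
by rewrite extDE h1 // h2 // addr0.
Qed.

Lemma homogeneousZ p c phi : homogeneous p phi -> homogeneous p (c *: phi).
Proof.
move=> /homogeneousP h1; apply/homogeneousP => I nI.
by rewrite extZE h1 // mulr0.
Qed.

Lemma homogeneous0 p : homogeneous p (0 : ext F N).
Proof. by apply/homogeneousP => I _; rewrite ffunE. Qed.

Lemma homogeneous_sum p (T : Type) (r : seq T) (P : pred T) (E : T -> ext F N) :
  (forall i, P i -> homogeneous p (E i)) ->
  homogeneous p (\sum_(i <- r | P i) E i).
Proof. by apply: big_ind; [exact: homogeneous0|exact: homogeneousD]. Qed.

Lemma homogeneous_ext_basis I : homogeneous #|I| (ext_basis F I).
Proof. by move=> K; rewrite ffunE; case: (K =P I) => [-> //|_]; rewrite eqxx. Qed.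

Lemma homogeneous_one : homogeneous 0 (ext_one : ext F N).
Proof. by have := @homogeneous_ext_basis set0; rewrite cards0. Qed.

Lemma homogeneous_covector a : homogeneous 1 (covector a).
Proof.
apply: homogeneous_sum => i _; apply: homogeneousZ; rewrite -(cards1 i).
exact: homogeneous_ext_basis.
Qed.

Lemma homogeneous_wedge p q phi psi :
  homogeneous p phi -> homogeneous q psi -> homogeneous (p + q) (wedge phi psi).
Proof.
move=> h1 h2 K; rewrite ffunE => nz.
have /exists_inP[I] : [exists I in powerset K, (phi I != 0) && (psi (K :\: I) != 0)].
  apply: contraNT nz; rewrite negb_exists_in => /forall_inP h0.
  rewrite big1 // => I /h0; rewrite negb_and !negbK.
  by case/orP=> /eqP->; rewrite ?mul0r ?mulr0 // mulr0.
rewrite powersetE => sIK /andP[/h1 <- /h2 <-].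
by rewrite cardsD (setIidPr sIK) subnKC // subset_leq_card.
Qed.

Lemma homogeneous_gt p phi : homogeneous p phi -> (N < p)%N -> phi = 0.
Proof.
move=> /homogeneousP h Np; apply/ffunP => I; rewrite h ?ffunE //.
by apply: contraTneq Np => <-; rewrite -leqNgt -[N in (_ <= N)%N]card_ord max_card.
Qed.

End Wedge.

(** * Covectors, vectors and the pairing *)

Section Coval.
Variables (F : numFieldType) (N : nat).
Implicit Types (a b X Y : 'cV[F]_N) (M : 'M[F]_N).

Lemma cV_sum_stdvec X : X = \sum_j X j 0 *: stdvec j.
Proof.
rewrite [LHS]matrix_sum_delta; apply: eq_bigr => i _.
by rewrite big_ord_recl big_ord0 addr0.
Qed.

Lemma coval_stdvec j X : coval (stdvec j) X = X j 0.
Proof.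
rewrite /coval (bigD1 j) //= mxE !eqxx mul1r big1 ?addr0 // => i ni.
by rewrite mxE (negPf ni) mul0r.
Qed.

Lemma covalZl c a X : coval (c *: a) X = c * coval a X.
Proof.
by rewrite /coval mulr_sumr; apply: eq_bigr => i _; rewrite mxE mulrA.
Qed.

Lemma covalE a X : coval a X = (a^T *m X) 0 0.
Proof. by rewrite /coval mxE; apply: eq_bigr => i _; rewrite mxE. Qed.

Lemma coval_mull M a X : coval (M *m a) X = coval a (M^T *m X).
Proof. by rewrite !covalE trmx_mul mulmxA. Qed.

Lemma covalDl a b X : coval (a + b) X = coval a X + coval b X.
Proof. by rewrite /coval -big_split; apply: eq_bigr => i _; rewrite mxE mulrDl. Qed.

Lemma covalDr a X Y : coval a (X + Y) = coval a X + coval a Y.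
Proof. by rewrite /coval -big_split; apply: eq_bigr => i _; rewrite mxE mulrDr. Qed.

Lemma covalZr c a X : coval a (c *: X) = c * coval a X.
Proof. by rewrite /coval mulr_sumr; apply: eq_bigr => i _; rewrite mxE mulrCA. Qed.

Lemma coval_sumr a (I : Type) (r : seq I) (Q : pred I) (E : I -> 'cV[F]_N) :
  coval a (\sum_(i <- r | Q i) E i) = \sum_(i <- r | Q i) coval a (E i).
Proof.
apply: (big_morph (coval a)) => [X Y|]; first exact: covalDr.
by rewrite -(scale0r 0) covalZr mul0r.
Qed.

Lemma covalNl a X : coval (- a) X = - coval a X.
Proof. by rewrite -scaleN1r covalZl mulN1r. Qed.

Lemma covalNr a X : coval a (- X) = - coval a X.
Proof. by rewrite -scaleN1r covalZr mulN1r. Qed.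

Lemma coval0l X : coval 0 X = 0.
Proof. by rewrite -(scale0r 0) covalZl mul0r. Qed.

Lemma coval0r a : coval a 0 = 0.
Proof. by rewrite -(scale0r 0) covalZr mul0r. Qed.

Lemma covalC a X : coval a X = coval X a.
Proof. by apply: eq_bigr => i _; rewrite mulrC. Qed.

Lemma coval_inj a b : (forall X, coval a X = coval b X) -> a = b.
Proof.
by move=> h; apply/matrixP=> i j; rewrite ord1 -!coval_stdvec covalC h covalC.
Qed.

Lemma eq_mulmx_cV (M M' : 'M[F]_N) :
  (forall v : 'cV[F]_N, M *m v = M' *m v) -> M = M'.
Proof.
move=> h; apply/matrixP => i j; have := h (stdvec j).
by rewrite /stdvec -!colE => /matrixP/(_ i 0); rewrite !mxE.
Qed.

Definition covalB := (covalDl, covalDr, covalNl, covalNr, covalZl, covalZr).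

End Coval.

Section Pairing.
Variables (F : numFieldType) (N : nat).

Lemma pairingE (u v : 'cV[F]_(N + N)) : pairing u v =
  2%:R^-1 * (coval (dsubmx u) (usubmx v) + coval (dsubmx v) (usubmx u)).
Proof. by rewrite /pairing big_split. Qed.

Lemma pairing_col_mx (X a Y b : 'cV[F]_N) :
  pairing (col_mx X a) (col_mx Y b) = 2%:R^-1 * (coval a Y + coval b X).
Proof. by rewrite pairingE !col_mxKu !col_mxKd. Qed.

Lemma pairingC (u v : 'cV[F]_(N + N)) : pairing u v = pairing v u.
Proof. by rewrite !pairingE addrC. Qed.

Lemma pairing_linear (u v w : 'cV[F]_(N + N)) c :
  pairing u (c *: v + w) = c * pairing u v + pairing u w.
Proof. rewrite !pairingE !linearP /= !covalB; ring. Qed.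

Lemma pairing0 (u : 'cV[F]_(N + N)) : pairing u 0 = 0.
Proof. by rewrite pairingE !linear0 coval0l coval0r addr0 mulr0. Qed.

Lemma pairing_nondeg (u : 'cV[F]_(N + N)) : (forall v, pairing u v = 0) -> u = 0.
Proof.
move=> h; have half0 : 2%:R^-1 != 0 :> F by rewrite invr_eq0 pnatr_eq0.
rewrite -[u]vsubmxK (_ : usubmx u = 0) 1?(_ : dsubmx u = 0) ?col_mx0 //.
  apply: coval_inj => X; rewrite coval0l; apply/eqP.
  move/eqP: (h (col_mx X 0)); rewrite pairingE col_mxKu col_mxKd coval0l addr0.
  by rewrite mulf_eq0 (negPf half0).
apply: coval_inj => X; rewrite coval0l; apply/eqP.
move/eqP: (h (col_mx 0 X)); rewrite pairingE col_mxKu col_mxKd coval0r add0r.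
by rewrite mulf_eq0 (negPf half0) covalC.
Qed.

End Pairing.

(** * Two-forms and their exponentials *)

Section TwoForms.
Variables (F : numFieldType) (N : nat).
Implicit Types (phi psi chi om : ext F N) (X Y a b : 'cV[F]_N) (S : 'M[F]_N).

(** The 2-form (X, Y) |-> (S X)(Y), for S antisymmetric; the sum over all j counts
    each e^j /\ e^l twice. *)
Definition two_form S : ext F N :=
  2%:R^-1 *: \sum_j wedge (covector (stdvec j)) (covector (S *m stdvec j)).

Lemma wedge_two_formE S phi : wedge (two_form S) phi = 2%:R^-1 *:
  \sum_j wedge (covector (stdvec j)) (wedge (covector (S *m stdvec j)) phi).
Proof.
rewrite /two_form wedgeZl wedge_suml; congr (_ *: _).
by apply: eq_bigr => j _; rewrite wedgeA.
Qed.

Lemma contract_wedge_two_form S X phi : S^T = - S ->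
  contract X (wedge (two_form S) phi) =
    wedge (covector (S *m X)) phi + wedge (two_form S) (contract X phi).
Proof.
move=> antiS.
rewrite !wedge_two_formE linearZ /= linear_sum /=.
have step j : contract X
      (wedge (covector (stdvec j)) (wedge (covector (S *m stdvec j)) phi)) =
    X j 0 *: wedge (covector (S *m stdvec j)) phi
    + ((S *m X) j 0 *: wedge (covector (stdvec j)) phi
    + wedge (covector (stdvec j))
        (wedge (covector (S *m stdvec j)) (contract X phi))).
  rewrite !contract_wedge_covector coval_stdvec coval_mull antiS.
  rewrite mulNmx linearB /= linearZ /=.
  have -> : coval (stdvec j) (- (S *m X)) = - (S *m X) j 0.
    by rewrite coval_stdvec mxE.
  by apply/ffunP=> I; rewrite !(extDE, extNE, extZE); ring.
rewrite (eq_bigr _ (fun j _ => step j)) !big_split /= !scalerDr addrA.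
congr (_ + _).
have -> : \sum_j X j 0 *: wedge (covector (S *m stdvec j)) phi =
    wedge (covector (S *m X)) phi.
  rewrite [in RHS](cV_sum_stdvec X) linear_sum /= linear_sum wedge_suml.
  by apply: eq_bigr => j _; rewrite -scalemxAr linearZ wedgeZl.
have -> : \sum_j (S *m X) j 0 *: wedge (covector (stdvec j)) phi =
    wedge (covector (S *m X)) phi.
  rewrite [in RHS](cV_sum_stdvec (S *m X)) linear_sum wedge_suml.
  by apply: eq_bigr => j _; rewrite linearZ wedgeZl.
by rewrite -scalerDl -[2%:R^-1]mul1r -splitr scale1r.
Qed.

Lemma wedge_two_form_covectorC S a phi :
  wedge (two_form S) (wedge (covector a) phi) =
    wedge (covector a) (wedge (two_form S) phi).
Proof.
rewrite !wedge_two_formE linearZ /=; congr (_ *: _).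
rewrite linear_sum; apply: eq_bigr => j _.
rewrite [X in wedge _ X = _]wedge_covectorC linearN /=.
by rewrite wedge_covectorC opprK.
Qed.

Lemma homogeneous_two_form S : homogeneous 2 (two_form S).
Proof.
apply: homogeneousZ; apply: homogeneous_sum => j _.
by rewrite -[2%N]/(1 + 1)%N; apply: homogeneous_wedge; apply: homogeneous_covector.
Qed.

Lemma wedge_powE om j phi : wedge (wedge_pow om j) phi = iter j (wedge om) phi.
Proof.
elim: j => [|j IH]; first by rewrite wedge1l.
by rewrite /wedge_pow iterS -/(wedge_pow om j) -wedgeA IH.
Qed.

Lemma wedge_expE om phi :
  wedge (wedge_exp om) phi = \sum_(j < N.+1) (j`!%:R)^-1 *: iter j (wedge om) phi.
Proof.
by rewrite wedge_suml; apply: eq_bigr => j _; rewrite wedgeZl wedge_powE.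
Qed.

Lemma homogeneous_wedge_pow p om j :
  homogeneous p om -> homogeneous (p * j) (wedge_pow om j).
Proof.
move=> hom; elim: j => [|j IH].
  by rewrite muln0; apply: homogeneous_one.
by rewrite mulnS; apply: homogeneous_wedge.
Qed.

Lemma iter_wedge_covectorC S j a phi :
  iter j (wedge (two_form S)) (wedge (covector a) phi) =
    wedge (covector a) (iter j (wedge (two_form S)) phi).
Proof. by elim: j => //= j ->; rewrite wedge_two_form_covectorC. Qed.

Lemma iter_wedge0 om j : iter j (wedge om) 0 = 0.
Proof. by elim: j => //= j ->; rewrite linear0. Qed.

(** Contraction by X acts on powers of a 2-form as an ordinary derivation, since
    2-forms commute with covectors. *)
Lemma contract_iter_two_form S X j phi : S^T = - S ->
  contract X (iter j.+1 (wedge (two_form S)) phi) =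
    j.+1%:R *: wedge (covector (S *m X)) (iter j (wedge (two_form S)) phi)
    + iter j.+1 (wedge (two_form S)) (contract X phi).
Proof.
move=> antiS; elim: j => [|j IH].
  by rewrite /= contract_wedge_two_form // scale1r.
rewrite iterS contract_wedge_two_form // IH linearD linearZ /=.
rewrite -[wedge _ (iter j _ _)]/(iter j.+1 _ phi) wedge_two_form_covectorC.
by rewrite addrA -{1}[wedge _ (wedge _ _)]scale1r -scalerDl -mulrS.
Qed.

(** The term-by-term derivative of the exponential series loses its top term
    omega^N / N!, which after wedging with a covector has degree 2 N + 1 > N. *)
Lemma contract_wedge_exp S X phi : S^T = - S ->
  contract X (wedge (wedge_exp (two_form S)) phi) =
    wedge (covector (S *m X)) (wedge (wedge_exp (two_form S)) phi)
    + wedge (wedge_exp (two_form S)) (contract X phi).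
Proof.
move=> antiS; rewrite !wedge_expE !linear_sum /= big_ord_recl.
rewrite [X in _ = X + _]big_ord_recr /= [X in _ = _ + X]big_ord_recl.
have -> : wedge (covector (S *m X)) ((N`!%:R)^-1 *: iter N (wedge (two_form S)) phi) = 0.
  rewrite linearZ /= -wedge_powE wedgeA.
  rewrite (@homogeneous_gt _ _ (1 + 2 * N) (wedge _ (wedge_pow _ _))) //.
  - by rewrite wedge0l scaler0.
  - apply: homogeneous_wedge; first exact: homogeneous_covector.
    by apply: homogeneous_wedge_pow; apply: homogeneous_two_form.
  - by rewrite add1n ltnS leq_pmull.
rewrite addr0 addrCA -linearZ; congr (_ + _).
rewrite -big_split; apply: eq_bigr => j _.
have := contract_iter_two_form X j phi antiS; rewrite lift0 !linearZ /= => ->.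
rewrite scalerDr scalerA; congr (_ *: _ + _).
by rewrite factS natrM invfM mulrAC mulVf ?mul1r // pnatr_eq0.
Qed.

Lemma wedge_exp_covectorC S a phi :
  wedge (covector a) (wedge (wedge_exp (two_form S)) phi) =
  wedge (wedge_exp (two_form S)) (wedge (covector a) phi).
Proof.
rewrite !wedge_expE linear_sum; apply: eq_bigr => j _.
by rewrite linearZ /= iter_wedge_covectorC.
Qed.

Lemma wedge_exp0 om : homogeneous 2 om -> wedge_exp om set0 = 1.
Proof.
move=> hom; rewrite /wedge_exp sum_ffunE big_ord_recl /= extZE ffunE eqxx.
rewrite fact0 invr1 mul1r big1 ?addr0 // => j _; rewrite extZE.
have /homogeneousP -> := homogeneous_wedge_pow (j := lift ord0 j) hom.
  by rewrite mulr0.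
by rewrite cards0 eq_sym muln_eq0.
Qed.

(** The component of lowest degree of exp(omega) /\ phi is phi. *)
Lemma wedge_exp_neq0 om p phi : homogeneous 2 om -> homogeneous p phi ->
  phi != 0 -> wedge (wedge_exp om) phi != 0.
Proof.
move=> hom hphi; apply: contra => /eqP e0; apply/eqP/ffunP=> I; rewrite [RHS]ffunE.
case: (eqVneq #|I| p) => [cI|]; last by move/homogeneousP: hphi; apply.
have := congr1 (fun f : ext F N => f I) e0; rewrite /= [RHS]ffunE ffunE.
rewrite (bigD1 set0) /=; last by rewrite powersetE sub0set.
rewrite setD0 shuffle_sign0l mul1r wedge_exp0 // mul1r big1 ?addr0 //.
move=> K /andP[]; rewrite powersetE => sKI nK0.
have /homogeneousP -> := hphi; first by rewrite !mulr0.
rewrite -cI cardsD (setIidPr sKI) neq_ltn ltn_subrL !card_gt0 nK0 /=.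
by apply/orP; left; apply: contraNneq nK0 => I0; rewrite -subset0 -I0.
Qed.

Lemma top_of_covector_annihilated p phi :
  homogeneous p phi -> phi != 0 ->
  (forall a, wedge (covector a) phi = 0) -> p = N.
Proof.
move=> hphi nz ann.
have [I nI] : exists I, phi I != 0.
  apply/existsP; apply: contraNT nz; rewrite negb_exists => /forallP h.
  by apply/eqP/ffunP=> I; rewrite [RHS]ffunE; apply/eqP; rewrite -[_ == _]negbK.
rewrite -(hphi I nI); suff -> : I = setT by rewrite cardsT card_ord.
apply/setP=> i; rewrite inE; apply: contraNT nI => niI.
have := congr1 (fun f : ext F N => f (i |: I)) (ann (stdvec i)).
rewrite /= wedge_covectorE [RHS]ffunE (bigD1 i) ?setU11 //= setU1K // mxE !eqxx.
rewrite mul1r big1 ?addr0 => [/eqP|j /andP[_ nji]]; last first.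
  by rewrite mxE (negPf nji) mul0r mulr0.
by rewrite mulf_eq0 signr_eq0.
Qed.

(** The hypothesis on covectors expresses that S is nondegenerate in the directions
    complementary to psi.  For the minimal j with S^(j+1) /\ psi = 0, contracting
    by X gives (S X) /\ S^j /\ psi = 0; hence all covectors kill the nonzero form
    S^j /\ psi, so that its degree is N. *)
Lemma two_form_pow_wedge_neq0 S p m psi : S^T = - S ->
  homogeneous p psi -> psi != 0 -> (p + 2 * m)%N = N ->
  (forall a, exists X b, [/\ a = S *m X + b, contract X psi = 0
      & wedge (covector b) psi = 0]) ->
  wedge (wedge_pow (two_form S) m) psi != 0.
Proof.
move=> antiS hpsi nz pm dec; rewrite wedge_powE; apply/negP => w0.
have ex : exists j, iter j (wedge (two_form S)) psi == 0 by exists m.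
case: (ex_minnP ex) => -[|j] j0 jmin; first by rewrite /= (negPf nz) in j0.
have jm := jmin _ w0.
have nzj : iter j (wedge (two_form S)) psi != 0.
  by apply/negP => /jmin; rewrite ltnn.
suff : (p + 2 * j)%N = N by lia.
apply: (top_of_covector_annihilated _ nzj).
  rewrite -wedge_powE addnC; apply: homogeneous_wedge => //.
  by apply: homogeneous_wedge_pow; apply: homogeneous_two_form.
move=> a; have [X [b [-> cX wb]]] := dec a.
rewrite linearD wedgeDl /= -[X in _ + X]iter_wedge_covectorC wb iter_wedge0 addr0.
have := contract_iter_two_form X j psi antiS.
rewrite (eqP j0) linear0 cX iter_wedge0 addr0 => /esym/eqP.
by rewrite scaler_eq0 pnatr_eq0 => /eqP.
Qed.

End TwoForms.

(** * Products of covectors *)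

Section WedgeProd.
Variables (F : numFieldType) (N : nat).
Implicit Types (a X : 'cV[F]_N) (s : seq 'cV[F]_N).

Definition wprod s : ext F N := \big[@wedge F N/ext_one]_(t <- s) covector t.

Lemma wprod_cons a s : wprod (a :: s) = wedge (covector a) (wprod s).
Proof. by rewrite /wprod big_cons. Qed.

Lemma wprod_nil : wprod [::] = ext_one.
Proof. by rewrite /wprod big_nil. Qed.

Lemma wprod_cat s1 s2 : wprod (s1 ++ s2) = wedge (wprod s1) (wprod s2).
Proof.
elim: s1 => [|a s IH]; first by rewrite wprod_nil wedge1l.
by rewrite cat_cons !wprod_cons IH wedgeA.
Qed.

Lemma homogeneous_wprod s : homogeneous (size s) (wprod s).
Proof.
elim: s => [|a s IH]; first by rewrite wprod_nil; apply: homogeneous_one.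
by rewrite wprod_cons; apply: (homogeneous_wedge (p := 1)) => //;
   apply: homogeneous_covector.
Qed.

Lemma contract_one X : contract X (ext_one : ext F N) = 0.
Proof.
apply/ffunP=> I; rewrite contractE [RHS]ffunE big1 // => i _.
rewrite ffunE (_ : (i |: I == set0) = false) ?mulr0 //.
by apply/negP => /eqP/setP/(_ i); rewrite setU11 inE.
Qed.

Lemma contract_wprod0 s X : (forall a, a \in s -> coval a X = 0) ->
  contract X (wprod s) = 0.
Proof.
elim: s => [|a s IH] ann; first by rewrite wprod_nil contract_one.
rewrite wprod_cons contract_wedge_covector ann ?mem_head // scale0r.
by rewrite IH ?linear0 ?subr0 ?addr0 // => b bs; rewrite ann // inE bs orbT.
Qed.

Lemma wedge_covector_sq a (phi : ext F N) :
  wedge (covector a) (wedge (covector a) phi) = 0.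
Proof.
have := wedge_covectorC a a phi; move: (wedge _ _) => x x_opp.
apply/ffunP => I; apply/eqP; rewrite [X in _ == X]ffunE -eqNr -extNE; apply/eqP.
by rewrite -x_opp.
Qed.

Lemma wedge_wprod_mem a s : a \in s -> wedge (covector a) (wprod s) = 0.
Proof.
elim: s => // b s IH; rewrite inE wprod_cons => /predU1P[->|/IH h].
  exact: wedge_covector_sq.
by rewrite wedge_covectorC h linear0 oppr0.
Qed.

Lemma wedge_wprod_span a s : a \in <<s>>%VS -> wedge (covector a) (wprod s) = 0.
Proof.
move=> /(coord_span (X := in_tuple s)) ->.
rewrite linear_sum wedge_suml big1 // => i _.
by rewrite linearZ wedgeZl wedge_wprod_mem ?scaler0 // mem_nth.
Qed.

(** Contracting a /\ (product of s) by a vector Y with a(Y) = 1 killed by the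
    members of s gives back the product of s. *)
Lemma wprod_free_neq0 s : free s -> wprod s != 0.
Proof.
elim: s => [_|a s IH fas].
  rewrite wprod_nil; apply/eqP => /ffunP/(_ set0)/eqP.
  by rewrite !ffunE eqxx oner_eq0.
(* Y is the first vector of a dual family: b |-> b(Y) is the first coordinate in
   the free family a :: s. *)
have fs : free s by move: fas; rewrite free_cons => /andP[].
pose T := in_tuple (a :: s); pose Y := \col_i coord T ord0 (stdvec i).
have YE b : coval b Y = coord T ord0 b.
  rewrite [in RHS](cV_sum_stdvec b) linear_sum; apply: eq_bigr => i _.
  by rewrite linearZ mxE.
rewrite wprod_cons; apply: contraNneq (IH fs) => w0.
have := congr1 (contract Y) w0; rewrite contract_wedge_covector linear0.
rewrite contract_wprod0 => [|b bs]; last first.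
  have bi : (index b s < size s)%N by rewrite index_mem.
  rewrite YE -(nth_index 0 bs) -[nth 0 s _]/(T`_(lift ord0 (Ordinal bi))).
  by rewrite (coord_free (X := T)).
rewrite linear0 subr0 YE.
have -> : coord T ord0 a = 1.
  by rewrite -[a]/(T`_(ord0 : 'I_(size s).+1)) (coord_free (X := T)).
by rewrite scale1r => ->.
Qed.

End WedgeProd.

(** * Extension of scalars for forms *)

Section MapForm.
Variables (F G : fieldType) (f : {rmorphism F -> G}) (N : nat).
Implicit Types (phi psi : ext F N).

Definition map_form phi : ext G N := [ffun I => f (phi I)].

Lemma map_form_sum (T : Type) (r : seq T) (P : pred T) (E : T -> ext F N) :
  map_form (\sum_(i <- r | P i) E i) = \sum_(i <- r | P i) map_form (E i).
Proof.
apply: (big_morph map_form) => [phi psi|]; apply/ffunP => I.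
  by rewrite [LHS]ffunE [RHS]extDE extDE !ffunE rmorphD.
by rewrite !ffunE rmorph0.
Qed.

Lemma map_formZ c phi : map_form (c *: phi) = f c *: map_form phi.
Proof.
by apply/ffunP => I; rewrite [LHS]ffunE [RHS]extZE extZE [map_form phi I]ffunE rmorphM.
Qed.

Lemma map_form_basis I : map_form (ext_basis F I) = ext_basis G I.
Proof. by apply/ffunP => K; rewrite !ffunE rmorph_nat. Qed.

Lemma map_form_wedge phi psi :
  map_form (wedge phi psi) = wedge (map_form phi) (map_form psi).
Proof.
apply/ffunP => K; rewrite !ffunE rmorph_sum; apply: eq_bigr => I _.
by rewrite !ffunE !rmorphM rmorph_sign.
Qed.

Lemma map_form_covector a : map_form (covector a) = covector (map_mx f a).
Proof.
rewrite map_form_sum; apply: eq_bigr => i _.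
by rewrite map_formZ map_form_basis mxE.
Qed.

End MapForm.

Lemma map_form_wprod (F G : numFieldType) (f : {rmorphism F -> G}) N
    (s : seq 'cV[F]_N) :
  map_form f (wprod s) = wprod [seq map_mx f a | a <- s].
Proof.
elim: s => [|a s IH] /=; first by rewrite !wprod_nil map_form_basis.
by rewrite !wprod_cons map_form_wedge map_form_covector IH.
Qed.

Lemma two_formZ (F : numFieldType) N c (S : 'M[F]_N) :
  two_form (c *: S) = c *: two_form S.
Proof.
rewrite /two_form [RHS]scalerA mulrC -[RHS]scalerA; congr (_ *: _).
rewrite scaler_sumr.
by apply: eq_bigr => j _; rewrite -scalemxAl !linearZ.
Qed.

Lemma map_two_form (F G : numFieldType) (f : {rmorphism F -> G}) N (S : 'M[F]_N) :
  map_form f (two_form S) = two_form (map_mx f S).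
Proof.
rewrite map_formZ map_form_sum fmorphV rmorph_nat; congr (_ *: _).
apply: eq_bigr => j _; rewrite map_form_wedge !map_form_covector map_mxM.
by rewrite /stdvec map_delta_mx.
Qed.

(** * Brackets with an abelian ideal of codimension one *)

Section LieBr.
Variables (F : numFieldType) (N : nat) (e : 'rV[F]_N) (D : 'M[F]_N).
Implicit Types (X Y Z : 'cV[F]_N).

(** The bracket for which D = ad e_0 and e is the coordinate along e_0, without
    reference to a block decomposition, so that one can compute with projections
    that commute with D. *)
Definition lie_br X Y := (e *m X) 0 0 *: (D *m Y) - (e *m Y) 0 0 *: (D *m X).

Lemma lie_brC X Y : lie_br X Y = - lie_br Y X.
Proof. by rewrite /lie_br opprB. Qed.

Lemma lie_br_is_linear X : linear (lie_br X).
Proof.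
move=> c Y Z; rewrite /lie_br !mulmxDr -!scalemxAr; apply/matrixP => i j.
rewrite !mxE; ring.
Qed.

HB.instance Definition _ X :=
  GRing.isLinear.Build F 'cV[F]_N 'cV[F]_N *:%R (lie_br X) (lie_br_is_linear X).

Lemma lie_brDr X Y Z : lie_br X (Y + Z) = lie_br X Y + lie_br X Z.
Proof. exact: (linearD (lie_br X)). Qed.

Lemma lie_brZr c X Y : lie_br X (c *: Y) = c *: lie_br X Y.
Proof. exact: (linearZ_LR (lie_br X)). Qed.

Lemma lie_brDl X Y Z : lie_br (X + Y) Z = lie_br X Z + lie_br Y Z.
Proof.
rewrite /lie_br !mulmxDr; apply/matrixP => i j; rewrite !mxE; ring.
Qed.

Lemma lie_brZl c X Y : lie_br (c *: X) Y = c *: lie_br X Y.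
Proof.
rewrite /lie_br -!scalemxAr; apply/matrixP => i j; rewrite !mxE; ring.
Qed.

Lemma coval_ad_star X a Z : coval (ad_star lie_br X a) Z = - coval a (lie_br X Z).
Proof.
rewrite [in RHS](cV_sum_stdvec Z) linear_sum coval_sumr -sumrN.
apply: eq_bigr => i _; rewrite mxE linearZ covalZr mulrC mulrN.
by congr (- (_ * _)).
Qed.

End LieBr.

Lemma map_lie_br (F G : numFieldType) (f : {rmorphism F -> G}) N
    (e : 'rV[F]_N) (D : 'M[F]_N) X Y :
  lie_br (map_mx f e) (map_mx f D) (map_mx f X) (map_mx f Y) =
  map_mx f (lie_br e D X Y).
Proof.
have eE (Z : 'cV[F]_N) : (map_mx f e *m map_mx f Z) 0 0 = f ((e *m Z) 0 0).
  by rewrite -map_mxM mxE.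
by rewrite /lie_br !eE map_mxB !map_mxZ !map_mxM.
Qed.

(** * Generalized complex structures in block form *)

(** P is the projection onto the complex part along the symplectic part, J the
    complex structure on the image of P, S the symplectic form and be its inverse,
    up to sign, on the kernel of P.  Each operator is extended by 0. *)
Record gc_blocks (F : numFieldType) N (P J S be : 'M[F]_N) : Prop := GcBlocks {
  gc_PJ : P *m J = J;
  gc_JP : J *m P = J;
  gc_JJ : J *m J = - P;
  gc_S : S^T = - S;
  gc_be : be^T = - be;
  gc_SP : S *m P = 0;
  gc_Pbe : P *m be = 0;
  gc_beS : be *m S = P - 1%:M;
  gc_Sbe : S *m be = P^T - 1%:M }.

Section GcBlocks.
Variables (F : numFieldType) (N : nat) (P J S be : 'M[F]_N).
Hypothesis H : gc_blocks P J S be.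

(** On the symplectic part, the sign of be S = - 1 makes the square - 1 and the
    i-eigenspace the graph of - i S. *)
Definition gc_mx : 'M[F]_(N + N) := block_mx J be S (- J^T).

Lemma gc_PP : P *m P = P.
Proof.
have := congr1 (mulmx P) (gc_JJ H).
by rewrite mulmxA (gc_PJ H) (gc_JJ H) mulmxN => /oppr_inj.
Qed.

Lemma gc_SJ : S *m J = 0.
Proof. by rewrite -(gc_PJ H) mulmxA (gc_SP H) mul0mx. Qed.

Lemma gc_PtS : P^T *m S = 0.
Proof.
by apply: trmx_inj; rewrite trmx_mul trmxK (gc_S H) mulNmx (gc_SP H) oppr0 trmx0.
Qed.

Lemma gc_JtS : J^T *m S = 0.
Proof. by rewrite -(gc_PJ H) trmx_mul -mulmxA gc_PtS mulmx0. Qed.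

Lemma gc_Jbe : J *m be = 0.
Proof. by rewrite -(gc_JP H) -mulmxA (gc_Pbe H) mulmx0. Qed.

Lemma gc_bePt : be *m P^T = 0.
Proof.
by apply: trmx_inj; rewrite trmx_mul trmxK (gc_be H) mulmxN (gc_Pbe H) oppr0 trmx0.
Qed.

Lemma gc_beJt : be *m J^T = 0.
Proof.
apply: trmx_inj; rewrite trmx_mul trmxK (gc_be H) mulmxN gc_Jbe.
by rewrite oppr0 trmx0.
Qed.

Lemma gc_JtJt : J^T *m J^T = - P^T.
Proof. by rewrite -trmx_mul (gc_JJ H) linearN. Qed.

Lemma gc_mx_sqr : gc_mx *m gc_mx = - 1%:M.
Proof.
rewrite /gc_mx mulmx_block mulmxN mulNmx mulNmx mulmxN opprK.
rewrite (gc_JJ H) (gc_beS H) (gc_Sbe H) gc_SJ gc_JtS gc_Jbe gc_beJt gc_JtJt.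
rewrite !oppr0 !addr0 addKr addrAC subrr add0r.
by rewrite [in RHS]scalar_mx_block opp_block_mx !oppr0.
Qed.

Lemma gc_mx_mul (X a : 'cV[F]_N) : gc_mx *m col_mx X a =
  col_mx (J *m X + be *m a) (S *m X - J^T *m a).
Proof. by rewrite /gc_mx mul_block_col mulNmx. Qed.

(** Expanding the left pairing, the terms with P cancel upon exchanging both
    arguments. *)
Lemma gc_mx_orthogonal_col (X a Y b : 'cV[F]_N) :
  pairing (gc_mx *m col_mx X a) (gc_mx *m col_mx Y b) =
  pairing (col_mx X a) (col_mx Y b).
Proof.
rewrite !gc_mx_mul !pairing_col_mx; congr (_ * _).
have side (Z c W d : 'cV[F]_N) : coval (S *m Z - J^T *m c) (J *m W + be *m d) =
    coval d Z - coval d (P *m Z) + coval c (P *m W).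
  rewrite !covalB !coval_mull !trmxK !mulmxA (gc_S H) !mulNmx gc_SJ gc_Jbe.
  rewrite (gc_Sbe H) (gc_JJ H) !mul0mx oppr0 !coval0r mulmxBl mul1mx mulNmx.
  rewrite !covalB [coval d (P *m _)]covalC [coval (P *m _) _]coval_mull.
  rewrite [coval d Z]covalC; ring.
rewrite !side; ring.
Qed.

Lemma gc_mx_orthogonal (u v : 'cV[F]_(N + N)) :
  pairing (gc_mx *m u) (gc_mx *m v) = pairing u v.
Proof. by rewrite -[u]vsubmxK -[v]vsubmxK gc_mx_orthogonal_col. Qed.

Variable im : F.
Hypothesis im_sqr : im * im = -1.

(** The first and last conditions are the (1,0) and (0,1) type conditions on the
    complex part; the middle one says that the symplectic part of a is - im S X.
    They are obtained by projecting both components with P and its transpose; on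
    the kernel of P, the upper component repeats the middle condition, because be
    inverts S there. *)
Lemma gc_eigenP (X a : 'cV[F]_N) :
  gc_mx *m col_mx X a = im *: col_mx X a <->
  [/\ J *m X = im *: (P *m X), S *m X = im *: (a - P^T *m a)
    & J^T *m a = - im *: (P^T *m a)].
Proof.
rewrite gc_mx_mul scale_col_mx; split=> [/eq_col_mx[top bot]|[h1 h2 h3]].
  split.
  - have := congr1 (mulmx P) top; rewrite mulmxDr !mulmxA (gc_PJ H) (gc_Pbe H).
    by rewrite mul0mx addr0 -scalemxAr.
  - have := congr1 (mulmx P^T) bot; rewrite mulmxBr !mulmxA gc_PtS mul0mx sub0r.
    rewrite -trmx_mul (gc_JP H) -scalemxAr scalerBr => <-.
    by rewrite -bot opprK addrNK.
  - have := congr1 (mulmx P^T) bot; rewrite mulmxBr !mulmxA gc_PtS mul0mx sub0r.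
    by rewrite -trmx_mul (gc_JP H) -scalemxAr scaleNr => <-; rewrite opprK.
congr col_mx.
  have -> : be *m a = be *m (a - P^T *m a) by rewrite mulmxBr mulmxA gc_bePt mul0mx subr0.
  have -> : a - P^T *m a = - im *: (S *m X).
    by rewrite h2 scalerA mulNr im_sqr opprK scale1r.
  rewrite -scalemxAr mulmxA (gc_beS H) h1 mulmxBl mul1mx scaleNr scalerBr opprB.
  by rewrite addrC addrNK.
by rewrite h2 h3 scaleNr opprK -scalerDr addrNK.
Qed.

(** The i-eigenspace contains its own orthogonal: all vectors w - im J w are in it,
    and J is skew for the pairing. *)
Lemma gc_eigen_of_isotropic (u : 'cV[F]_(N + N)) :
  (forall v, gc_mx *m v = im *: v -> pairing u v = 0) -> gc_mx *m u = im *: u.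
Proof.
move=> iso.
have skew w : pairing u (gc_mx *m w) = - pairing (gc_mx *m u) w.
  rewrite -(gc_mx_orthogonal u) mulmxA gc_mx_sqr mulNmx mul1mx.
  by rewrite -scaleN1r -[_ *: w]addr0 pairing_linear pairing0 addr0 mulN1r.
suff u0 : im *: (gc_mx *m u) + u = 0.
  move: u0 => /eqP; rewrite addrC addr_eq0 => /eqP {2}->.
  by rewrite scalerN scalerA im_sqr scaleN1r opprK.
apply: pairing_nondeg => w; rewrite pairingC pairing_linear !(pairingC w).
have <- : pairing u (- im *: (gc_mx *m w) + w) = 0.
  apply: iso; rewrite mulmxDr -scalemxAr mulmxA gc_mx_sqr mulNmx mul1mx scalerDr.
  by rewrite scalerA mulrN im_sqr opprK scale1r scaleNr scalerN opprK addrC.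
by rewrite pairing_linear skew mulrNN.
Qed.

(** * Integrability *)
Variables (e : 'rV[F]_N) (D : 'M[F]_N).
Hypotheses (eP : e *m P = e) (DP : D *m P = P *m D) (SD : S *m D = - (D^T *m S)).

Definition nijenhuis X Y := lie_br e D (J *m X) (J *m Y) - J *m lie_br e D (J *m X) Y
  - J *m lie_br e D X (J *m Y) - P *m lie_br e D X Y.

Hypothesis nijenhuis0 : forall X Y, nijenhuis X Y = 0.

Local Notation br := (lie_br e D).

Lemma lie_br_proj X Y : br (P *m X) (P *m Y) = P *m br X Y.
Proof.
by rewrite /lie_br !mulmxA eP DP mulmxBr -!scalemxAr !mulmxA.
Qed.

Lemma J_lie_br_projl X Y : J *m br (P *m X) Y = J *m br X Y.
Proof.
by rewrite /lie_br !mulmxA eP DP !mulmxBr -!scalemxAr !mulmxA (gc_JP H).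
Qed.

Lemma J_lie_br_projr X Y : J *m br X (P *m Y) = J *m br X Y.
Proof. by rewrite lie_brC mulmxN J_lie_br_projl lie_brC mulmxN opprK. Qed.

(** The classical consequence of integrability: vectors of type (1,0) are closed
    under the bracket. *)
Lemma lie_br_eigen X Y : J *m X = im *: (P *m X) -> J *m Y = im *: (P *m Y) ->
  J *m br X Y = im *: (P *m br X Y).
Proof.
move=> hX hY; have := nijenhuis0 X Y; rewrite /nijenhuis hX hY !lie_brZl !linearZ /=.
rewrite scalerA im_sqr lie_br_proj J_lie_br_projl J_lie_br_projr.
move: (J *m _) (P *m _) => JZ PZ h.
have : 2%:R *: (im *: JZ + PZ) = 0.
  rewrite -oppr0 -h; apply/matrixP => i j; rewrite !mxE; ring.
move/eqP; rewrite scaler_eq0 pnatr_eq0 /= addrC addr_eq0 => /eqP ->.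
by rewrite scalerN scalerA im_sqr scaleN1r opprK.
Qed.

(** By gc_eigenP there are three conditions.  The vector part is lie_br_eigen.
    For the covector part zeta, a covector a of L is evaluated on W as
    a(P W) - im S(Z, W), where Z is its vector companion (split_form).  On the
    symplectic part, the brackets only involve D, and invariance of S under D
    gives the value - im S([X, Y], .).  On the complex part it suffices that
    zeta kills all T of type (1,0): there the brackets with X and Y are again of
    type (1,0) and killed by the complex parts of xi and eta, while the remaining
    terms cancel by invariance of S. *)
Lemma courant_eigenspace (u v : 'cV[F]_(N + N)) :
  gc_mx *m u = im *: u -> gc_mx *m v = im *: v ->
  gc_mx *m courant br u v = im *: courant br u v.
Proof.
rewrite -[u]vsubmxK -[v]vsubmxK; move: (usubmx u) (dsubmx u) (usubmx v) (dsubmx v).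
move=> X xi Y eta /gc_eigenP[hX sX hxi] /gc_eigenP[hY sY heta].
rewrite /courant !col_mxKu !col_mxKd; apply/gc_eigenP.
pose sg Z W := coval (S *m Z) W.
set zeta := ad_star br X eta - ad_star br Y xi.
have zetaE Z : coval zeta Z = - coval eta (br X Z) + coval xi (br Y Z).
  by rewrite /zeta covalDl covalNl !coval_ad_star opprK.
have split_form (a Z W : 'cV[F]_N) : S *m Z = im *: (a - P^T *m a) ->
    coval a W = coval a (P *m W) - im * sg Z W.
  move=> hs; rewrite /sg hs !covalB coval_mull trmxK mulrA im_sqr; ring.
have type_form a W : J^T *m a = - im *: (P^T *m a) ->
    coval a (J *m W) = - im * coval a (P *m W).
  move=> ha; have := congr1 (fun b => coval b W) ha; rewrite /= !covalB !coval_mull.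
  by rewrite !trmxK.
(* sg is the symplectic form; it is antisymmetric, infinitesimally invariant
   under D and vanishes on the image of P. *)
have sgC Z W : sg Z W = - sg W Z.
  by rewrite /sg coval_mull (gc_S H) mulNmx covalNr covalC.
have sgD Z W : sg (D *m Z) W = - sg Z (D *m W).
  by rewrite /sg mulmxA SD mulNmx covalNl -mulmxA (coval_mull D^T) trmxK.
have sgPr Z W : sg Z (P *m W) = 0.
  by rewrite sgC /sg mulmxA (gc_SP H) mul0mx coval0l oppr0.
split; first exact: lie_br_eigen.
- apply: coval_inj => Z; pose Z' := Z - P *m Z.
  have eZ' : (e *m Z') 0 0 = 0 by rewrite mulmxBr mulmxA eP subrr mxE.
  have PDZ' : P *m (D *m Z') = 0.
    by rewrite mulmxA -DP -mulmxA mulmxBr mulmxA (gc_PP) subrr mulmx0.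
  have brZ' W : br W Z' = (e *m W) 0 0 *: (D *m Z').
    by rewrite /lie_br eZ' scale0r subr0.
  rewrite covalZl covalDl covalNl (coval_mull P^T) trmxK -covalNr -covalDr -/Z'.
  rewrite zetaE !brZ' !covalZr (split_form _ _ _ sY) (split_form _ _ _ sX) PDZ'.
  rewrite !coval0r -/(sg _ Z).
  have -> : sg (br X Y) Z = sg (br X Y) Z'.
    by rewrite /sg covalDr covalNr -![coval _ _]/(sg _ _) sgPr subr0.
  clearbody Z'; rewrite {1}/lie_br /sg mulmxBr -!scalemxAr !covalB -!/(sg _ _) !sgD.
  transitivity (im * im * ((e *m X) 0 0 * sg Y (D *m Z')
                           - (e *m Y) 0 0 * sg X (D *m Z'))); last by ring.
  rewrite im_sqr; ring.
- apply: coval_inj => Z; pose T := J *m Z + im *: (P *m Z).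
  have PT : P *m T = T.
    by rewrite mulmxDr -scalemxAr !mulmxA (gc_PJ H) gc_PP.
  have JT : J *m T = im *: (P *m T).
    rewrite PT mulmxDr -scalemxAr !mulmxA (gc_JJ H) (gc_JP H) scalerDr scalerA im_sqr.
    by rewrite mulNmx scaleN1r addrC.
  suff : coval zeta T = 0.
    rewrite covalDr covalZr covalZl (coval_mull P^T) (coval_mull J^T) !trmxK => /eqP.
    by rewrite addr_eq0 mulNr => /eqP.
  have main W c : J *m W = im *: (P *m W) -> S *m W = im *: (c - P^T *m c) ->
      J^T *m c = - im *: (P^T *m c) -> forall U, J *m U = im *: (P *m U) ->
      coval c (br U T) = im * (e *m T) 0 0 * sg W (D *m U).
    move=> hW sW hc U hU; rewrite (split_form _ _ _ sW).
    have := type_form c (br U T) hc; rewrite lie_br_eigen // covalZr => h0.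
    have -> : coval c (P *m br U T) = 0.
      have : (2%:R * im) * coval c (P *m br U T) = 0.
        by rewrite mulrDl mulrDl mul1r {1}h0 mulNr addNr.
      move/eqP; rewrite !mulf_eq0 pnatr_eq0 /=; case/orP => /eqP // im0.
      by move: im_sqr; rewrite im0 mul0r => /esym/eqP; rewrite oppr_eq0 oner_eq0.
    rewrite {1}/lie_br -PT mulmxA DP -mulmxA PT /sg !covalB -!/(sg _ _) sgPr.
    rewrite -/(sg _ _); ring.
  rewrite zetaE (main Y) // (main X) //.
  have -> : sg Y (D *m X) = sg X (D *m Y) by rewrite sgC sgD opprK.
  ring.
Qed.

End GcBlocks.

Section NijLinear.
Variables (F : numFieldType) (N : nat).
Variables (P J D : 'M[F]_N) (e : 'rV[F]_N).

Lemma nijenhuis_is_linear X : linear (nijenhuis P J e D X).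
Proof.
exact: (linearP ((lie_br e D (J *m X) \o mulmx J)
  \- (mulmx J \o lie_br e D (J *m X))
  \- (mulmx J \o (lie_br e D X \o mulmx J)) \- (mulmx P \o lie_br e D X))).
Qed.

HB.instance Definition _ X :=
  GRing.isLinear.Build F 'cV[F]_N 'cV[F]_N *:%R
    (nijenhuis P J e D X) (nijenhuis_is_linear X).

Lemma nijenhuisC X Y : nijenhuis P J e D X Y = - nijenhuis P J e D Y X.
Proof.
rewrite /nijenhuis (lie_brC _ _ (J *m X) (J *m Y)) (lie_brC _ _ (J *m X) Y).
rewrite (lie_brC _ _ X (J *m Y)) (lie_brC _ _ X Y).
do 4 move: (lie_br e D _ _) => ?.
by rewrite !mulmxN; apply/matrixP => i j; rewrite !mxE; ring.
Qed.

(** By bilinearity, so that the vanishing survives an extension of scalars. *)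
Lemma nijenhuis_stdvec : (forall i j, nijenhuis P J e D (stdvec i) (stdvec j) = 0) ->
  forall X Y, nijenhuis P J e D X Y = 0.
Proof.
move=> h0; have h1 j X : nijenhuis P J e D X (stdvec j) = 0.
  rewrite nijenhuisC (cV_sum_stdvec X) linear_sum big1 ?oppr0 // => i _.
  by rewrite linearZ /= h0 scaler0.
move=> X Y; rewrite (cV_sum_stdvec Y) linear_sum big1 // => j _.
by rewrite linearZ /= h1 scaler0.
Qed.

End NijLinear.

Section NijMap.
Variables (F G : numFieldType) (f : {rmorphism F -> G}) (N : nat).
Variables (P J D : 'M[F]_N) (e : 'rV[F]_N).

Lemma nijenhuis_map : (forall X Y, nijenhuis P J e D X Y = 0) ->
  forall X Y, nijenhuis (map_mx f P) (map_mx f J) (map_mx f e) (map_mx f D) X Y = 0.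
Proof.
move=> nijenhuis0; apply: nijenhuis_stdvec => i j.
have std q : stdvec q = map_mx f (stdvec q) by rewrite /stdvec map_delta_mx.
rewrite !std /nijenhuis -!map_mxM !map_lie_br -!map_mxM -!map_mxB.
by rewrite -/(nijenhuis P J e D _ _) nijenhuis0 map_mx0.
Qed.

End NijMap.

Lemma gc_blocks_map (F G : numFieldType) (f : {rmorphism F -> G}) N
    (P J S be : 'M[F]_N) : gc_blocks P J S be ->
  gc_blocks (map_mx f P) (map_mx f J) (map_mx f S) (map_mx f be).
Proof.
case=> h1 h2 h3 h4 h5 h6 h7 h8 h9; split; rewrite -?map_mxM ?map_trmx.
- by rewrite h1.
- by rewrite h2.
- by rewrite h3 map_mxN.
- by rewrite h4 map_mxN.
- by rewrite h5 map_mxN.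
- by rewrite h6 map_mx0.
- by rewrite h7 map_mx0.
- by rewrite h8 map_mxB map_mx1.
- by rewrite h9 map_mxB map_mx1.
Qed.

Lemma gc_mx_map (F G : numFieldType) (f : {rmorphism F -> G}) N
    (J S be : 'M[F]_N) :
  map_mx f (gc_mx J S be) = gc_mx (map_mx f J) (map_mx f S) (map_mx f be).
Proof. by rewrite /gc_mx map_block_mx map_mxN map_trmx. Qed.

(** * The pure spinor *)

Section Spinor.
Variables (F : numFieldType) (N : nat) (P J S be : 'M[F]_N) (im : F).
Hypothesis H : gc_blocks P J S be.
Hypothesis im_sqr : im * im = -1.
Variable s : seq 'cV[F]_N.
Hypothesis s_type : forall t, t \in s -> P^T *m t = t /\ J^T *m t = - im *: t.
Hypothesis s_span : forall a, J^T *m a = - im *: (P^T *m a) -> P^T *m a \in <<s>>%VS.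

Let rho := wedge (wedge_exp (two_form (im *: S))) (wprod s).

Lemma im_neq0 : im != 0.
Proof. by apply: contra_eq_neq im_sqr => ->; rewrite mul0r eq_sym oppr_eq0 oner_eq0. Qed.

(** Contraction of exp(im S) by X yields the covector im S X, which cancels the
    symplectic part of a; the complex part of a is in the span of s, hence kills
    the product; and the members of s, being of type (0,1), vanish on X. *)
Lemma eigen_clifford0 u : gc_mx J S be *m u = im *: u -> clifford u rho = 0.
Proof.
rewrite -[u]vsubmxK; move: (usubmx u) (dsubmx u) => X a /(gc_eigenP H im_sqr)[hX hS ha].
rewrite /clifford col_mxKu col_mxKd /rho contract_wedge_exp; last first.
  by rewrite linearZ /= (gc_S H) scalerN.
rewrite addrAC -wedgeDl -linearD -scalemxAl hS scalerA im_sqr scaleN1r opprB addrNK.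
rewrite wedge_exp_covectorC -linearD wedge_wprod_span ?s_span // add0r.
rewrite contract_wprod0 ?linear0 // => t /s_type[tP tJ].
have : (2%:R * im) * coval t X = 0.
  have e1 : coval t (J *m X) = im * coval t X.
    by rewrite hX covalZr -{2}tP coval_mull trmxK.
  have e2 : coval t (J *m X) = - im * coval t X.
    by rewrite -covalZl -tJ coval_mull trmxK.
  by rewrite mulrDl mulrDl mul1r -{2}e1 e2 mulNr subrr.
by move/eqP; rewrite !mulf_eq0 pnatr_eq0 (negPf im_neq0) => /eqP.
Qed.

(** If u kills rho, then the Clifford relation makes it orthogonal to the whole
    eigenspace, which contains its own orthogonal. *)
Lemma eigen_iff_clifford0 u : rho != 0 ->
  (gc_mx J S be *m u == im *: u) = (clifford u rho == 0).
Proof.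
move=> nz; apply/eqP/eqP => [|cu0]; first exact: eigen_clifford0.
apply: (gc_eigen_of_isotropic H im_sqr) => v /eigen_clifford0 cv0.
have := clifford_relation u v rho.
rewrite cv0 cu0 /clifford !linear0 !addr0 => /esym/eqP.
by rewrite scaler_eq0 (negPf nz) orbF /pairing => /eqP ->; rewrite mulr0.
Qed.

End Spinor.

(** * The covectors of type (0,1) *)

Section RowSeq.
Variables (F : fieldType) (r N : nat) (B : 'M[F]_(r, N)).

Definition row_seq : seq 'cV[F]_N := [seq (row i B)^T | i <- enum 'I_r].

Lemma size_row_seq : size row_seq = r.
Proof. by rewrite size_map size_enum_ord. Qed.

Lemma mem_row_seq t : t \in row_seq -> (t^T <= B)%MS.
Proof. by case/mapP => i _ ->; rewrite trmxK row_sub. Qed.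

Lemma row_seq_sum (c : 'rV[F]_r) : (c *m B)^T = \sum_i c 0 i *: (row i B)^T.
Proof. by rewrite mulmx_sum_row linear_sum; apply: eq_bigr => i _; rewrite linearZ. Qed.

Lemma span_row_seq a : (a \in <<row_seq>>%VS) = (a^T <= B)%MS.
Proof.
apply/idP/idP => [/(coord_span (X := in_tuple row_seq)) ->|].
  rewrite linear_sum; apply: summx_sub => i _; rewrite linearZ /=.
  by apply/scalemx_sub/mem_row_seq/mem_nth.
case/submxP => c /(congr1 trmx); rewrite trmxK => ->; rewrite row_seq_sum.
apply: memv_suml => i _; apply/memvZ/memv_span/mapP; exists i => //.
by rewrite mem_enum.
Qed.

Lemma free_row_seq : row_free B -> free row_seq.
Proof.
move=> fB; have sz : size row_seq == r by rewrite size_row_seq.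
apply/(freeP (X := Tuple sz)) => k k0 i.
have : (\row_i k i) *m B = 0.
  apply: trmx_inj; rewrite row_seq_sum trmx0 -[RHS]k0; apply: eq_bigr => j _.
  rewrite mxE; congr (_ *: _).
  by rewrite /= (nth_map j) ?size_enum_ord // nth_ord_enum.
rewrite -[RHS](mul0mx _ B) => /(row_free_inj fB)/matrixP/(_ 0 i).
by rewrite !mxE.
Qed.

End RowSeq.

Section TypeProj.
Variables (F : numFieldType) (N : nat) (P J : 'M[F]_N) (im : F).
Hypotheses (PJ : P *m J = J) (JP : J *m P = J) (JJ : J *m J = - P).
Hypothesis im_sqr : im * im = -1.

(** For c = im or c = - im, the projector onto the eigenspace of J for - c in the
    image of P; acting on rows from the right, onto the t with t J = - c t. *)
Definition type_proj (c : F) : 'M[F]_N := 2%:R^-1 *: (P + c *: J).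

Lemma type_projP c : P *m P = P -> type_proj c *m P = type_proj c.
Proof. by move=> PP; rewrite -scalemxAl mulmxDl -scalemxAl PP JP. Qed.

Lemma type_proj_add : type_proj im + type_proj (- im) = P.
Proof.
rewrite -scalerDr addrACA scaleNr subrr addr0 -[P + P]mulr2n -scaler_nat scalerA.
by rewrite mulVf ?pnatr_eq0 // scale1r.
Qed.

Lemma type_proj_mul c d : P *m P = P ->
  type_proj c *m type_proj d =
    4%:R^-1 *: ((1 - c * d) *: P + (c + d) *: J).
Proof.
move=> PP; rewrite /type_proj -scalemxAl -scalemxAr scalerA -invfM -natrM.
congr (_ *: _); rewrite mulmxDl !mulmxDr -!scalemxAl -!scalemxAr PP PJ JP JJ.
apply/matrixP => i j; rewrite !mxE; ring.
Qed.

Lemma type_proj_orth c d : P *m P = P -> c * d = 1 -> c + d = 0 ->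
  type_proj c *m type_proj d = 0.
Proof.
by move=> PP cd1 cd0; rewrite type_proj_mul // cd1 cd0 subrr !scale0r addr0 scaler0.
Qed.

Lemma type_proj_idem : P *m P = P -> type_proj im *m type_proj im = type_proj im.
Proof.
move=> PP; rewrite type_proj_mul // im_sqr opprK -!mulr2n -[im *+ 2]mulr_natl.
rewrite -scalerA -scalerDr scalerA; congr (_ *: _).
by rewrite -[4%N]/(2 * 2)%N natrM invfM mulfVK // pnatr_eq0.
Qed.

End TypeProj.

Section Thetas.
Variables (C : numFieldType) (cj : {rmorphism C -> C}) (im : C) (N : nat).
Variables (P J S be : 'M[C]_N) (k : nat).
Hypotheses (im_sqr : im * im = -1) (cj_im : cj im = - im).
Hypotheses (cjP : map_mx cj P = P) (cjJ : map_mx cj J = J).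
Hypothesis HC : gc_blocks P J S be.
Hypotheses (rankP : \rank P = (2 * k)%N).

Local Notation Pi := (type_proj P J im).
Local Notation Pib := (type_proj P J (- im)).

Lemma conj_type_proj : map_mx cj Pi = Pib.
Proof.
by rewrite /type_proj map_mxZ map_mxD map_mxZ cjP cjJ fmorphV rmorph_nat cj_im.
Qed.

Let PiPi : Pi *m Pi = Pi.
Proof.
exact: (type_proj_idem (gc_PJ HC) (gc_JP HC) (gc_JJ HC) im_sqr (gc_PP HC)).
Qed.

Let PibPi : Pib *m Pi = 0.
Proof.
apply: (type_proj_orth (gc_PJ HC) (gc_JP HC) (gc_JJ HC) (gc_PP HC)).
  by rewrite mulNr im_sqr opprK.
by rewrite addNr.
Qed.

Lemma type_proj_cap : (Pi :&: Pib = 0)%MS.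
Proof.
apply/eqP; rewrite -submx0; apply/rV_subP => v; rewrite sub_capmx.
case/andP => /submxP[a va] /submxP[b vb].
have : v *m Pi = 0 by rewrite vb -mulmxA PibPi mulmx0.
by rewrite va -mulmxA PiPi => ->; rewrite sub0mx.
Qed.

(** The two conjugate projectors are complementary in the image of P and have the
    same rank. *)
Lemma rank_type_proj : \rank Pi = k.
Proof.
have eqr : \rank Pib = \rank Pi by rewrite -conj_type_proj mxrank_map.
have : \rank (Pi + Pib)%MS = \rank P.
  apply/eqP; rewrite eqn_leq; apply/andP; split; apply: mxrankS.
    rewrite addsmx_sub; apply/andP; split; apply/submxP.
      by exists Pi; rewrite type_projP ?(gc_PP HC) ?(gc_JP HC).
    by exists Pib; rewrite type_projP ?(gc_PP HC) ?(gc_JP HC).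
  by rewrite -{1}(type_proj_add P J im) addmx_sub_adds.
rewrite mxrank_disjoint_sum ?type_proj_cap // eqr rankP; lia.
Qed.

Definition thetas := row_seq (row_base Pi).

Lemma size_thetas : size thetas = k.
Proof. by rewrite size_row_seq rank_type_proj. Qed.

Lemma mem_thetas t : t \in thetas -> Pi^T *m t = t.
Proof.
move/mem_row_seq; rewrite eq_row_base => /submxP[c tE].
by apply: trmx_inj; rewrite trmx_mul trmxK tE -mulmxA PiPi.
Qed.

Lemma span_thetas a : Pi^T *m a \in <<thetas>>%VS.
Proof. by rewrite span_row_seq eq_row_base trmx_mul trmxK submxMl. Qed.

Definition conj_thetas := [seq map_mx cj t | t <- thetas].

Lemma conj_thetasE : conj_thetas = row_seq (map_mx cj (row_base Pi)).
Proof.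
by rewrite /conj_thetas /row_seq -map_comp; apply: eq_map => i /=;
   rewrite -map_row map_trmx.
Qed.

Lemma mem_conj_thetas t : t \in conj_thetas -> Pib^T *m t = t.
Proof.
by case/mapP => u /mem_thetas h ->; rewrite -conj_type_proj map_trmx -map_mxM h.
Qed.

Lemma span_conj_thetas a : Pib^T *m a \in <<conj_thetas>>%VS.
Proof.
rewrite conj_thetasE span_row_seq trmx_mul trmxK -conj_type_proj.
apply: (submx_trans (submxMl _ _)); rewrite map_submx.
by rewrite eq_row_base.
Qed.

Lemma free_thetas : free thetas.
Proof. exact/free_row_seq/row_base_free. Qed.

Lemma free_thetas_cat : free (thetas ++ conj_thetas).
Proof.
rewrite cat_free free_thetas /=; apply/andP; split.
  by rewrite conj_thetasE; apply/free_row_seq; rewrite row_free_map row_base_free.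
apply/directv_addP/eqP; rewrite -subv0; apply/subvP => v.
rewrite memv_cap => /andP[].
have fix1 (M : 'M[C]_N) (s : seq 'cV[C]_N) : (forall t, t \in s -> M *m t = t) ->
    forall v, v \in <<s>>%VS -> M *m v = v.
  move=> h w /(coord_span (X := in_tuple s)) ->; rewrite linear_sum.
  by apply: eq_bigr => i _; rewrite linearZ /= h // mem_nth.
move=> /(fix1 _ _ mem_thetas) e1 /(fix1 _ _ mem_conj_thetas) e2.
rewrite -e1 -e2.
by rewrite mulmxA -trmx_mul PibPi trmx0 mul0mx mem0v.
Qed.

Lemma thetas_type t : t \in thetas ->
  P^T *m t = t /\ J^T *m t = - im *: t.
Proof.
move=> /mem_thetas tE; split; rewrite -{1}tE mulmxA -trmx_mul.
  by rewrite type_projP ?(gc_PP HC) ?(gc_JP HC).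
have -> : Pi *m J = - im *: Pi.
  rewrite /type_proj -scalemxAl mulmxDl -scalemxAl (gc_PJ HC) (gc_JJ HC).
  rewrite [RHS]scalerA mulrC -[RHS]scalerA; congr (_ *: _).
  by rewrite scalerDr scalerA mulNr im_sqr opprK scale1r scaleNr scalerN addrC.
by rewrite linearZ /= -scalemxAl tE.
Qed.

Lemma thetas_span a : J^T *m a = - im *: (P^T *m a) ->
  P^T *m a \in <<thetas>>%VS.
Proof.
move=> h; rewrite (_ : _ *m a = Pi^T *m a) ?span_thetas //.
rewrite /type_proj linearZ linearD /= linearZ /= -scalemxAl mulmxDl -scalemxAl h.
rewrite scalerA mulrN im_sqr opprK scale1r -mulr2n -scaler_nat scalerA.
by rewrite mulVf ?pnatr_eq0 // scale1r.
Qed.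

(** Every covector a is S (- be a) + P^T a: the vector be a is killed by P, hence
    by all the thetas and their conjugates, and P^T a is in their span. *)
Lemma thetas_top_neq0 n : N = (2 * n)%N -> (k <= n)%N ->
  wedge (wedge_pow (two_form S) (n - k)) (wprod (thetas ++ conj_thetas)) != 0.
Proof.
move=> evenN kn; apply: (@two_form_pow_wedge_neq0 _ _ _ (2 * k)).
- exact: gc_S HC.
- have := @homogeneous_wprod C N (thetas ++ conj_thetas).
  by rewrite size_cat [size conj_thetas]size_map size_thetas addnn mul2n.
- exact: wprod_free_neq0 free_thetas_cat.
- lia.
move=> a; exists (- (be *m a)), (P^T *m a); split.
- by rewrite mulmxN mulmxA (gc_Sbe HC) mulmxBl mul1mx opprB addrNK.
- apply: contract_wprod0 => t tin; rewrite covalNr.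
  have -> : t = P^T *m t.
    move: tin; rewrite mem_cat => /orP[/thetas_type[-> //]|].
    case/mapP => u /thetas_type[/(congr1 (map_mx cj))]; rewrite map_mxM => + _ ->.
    by rewrite -map_trmx cjP.
  by rewrite coval_mull trmxK mulmxA (gc_Pbe HC) mul0mx coval0r oppr0.
- apply: wedge_wprod_span; rewrite span_cat.
  rewrite -{1}(type_proj_add P J im) linearD mulmxDl.
  by apply: memv_add; [apply: span_thetas|apply: span_conj_thetas].
Qed.

End Thetas.

(** * The type of the structure *)

Section HasType.
Variables (R : realType) (N n k : nat) (P J S be : 'M[R]_N).
Hypothesis H : gc_blocks P J S be.
Hypotheses (rankP : \rank P = (2 * k)%N) (evenN : N = (2 * n)%N) (kn : (k <= n)%N).

Local Notation tc := (@to_complex R _ _).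
Local Notation cj := (@conjc R).

Lemma imaginary_sqr : 'i%C * 'i%C = -1 :> R[i].
Proof. by rewrite -expr2 sqr_i. Qed.

Lemma conj_imaginary : cj 'i%C = - 'i%C.
Proof. by simpc. Qed.

Lemma conj_to_complex p q (M : 'M[R]_(p, q)) : map_mx cj (tc M) = tc M.
Proof. by apply/matrixP => i j; rewrite !mxE conjc_real. Qed.

Let HC : gc_blocks (tc P) (tc J) (tc S) (tc be) := gc_blocks_map (real_complex R) H.

Lemma has_type_gc_mx : has_type (gc_mx J S be) k.
Proof.
have rankPC : \rank (tc P) = (2 * k)%N by rewrite mxrank_map.
pose s := thetas 'i%C (tc P) (tc J).
have frees : free s := free_thetas _ _ _.
have szt : size s == k.
  by rewrite (size_thetas imaginary_sqr conj_imaginary (conj_to_complex P)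
    (conj_to_complex J) HC rankPC).
have := thetas_top_neq0 imaginary_sqr conj_imaginary (conj_to_complex P)
  (conj_to_complex J) HC rankPC evenN kn; rewrite -/s => top.
have rho_neq0 : wedge (wedge_exp (two_form ('i%C *: tc S))) (wprod s) != 0.
  apply: (wedge_exp_neq0 (@homogeneous_two_form _ _ _) (@homogeneous_wprod _ _ s)).
  exact: wprod_free_neq0.
exists (wedge (wedge_exp (two_form ('i%C *: tc S))) (wprod s)); split.
  split=> // u; rewrite inE /to_complex gc_mx_map.
  exact: (eigen_iff_clifford0 HC imaginary_sqr (thetas_type imaginary_sqr HC)
    (thetas_span imaginary_sqr)).
have eform : complexify_form 0 + 'i%C *: complexify_form (two_form S) =
    two_form ('i%C *: tc S).
  have -> : complexify_form (0 : ext R N) = 0.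
    by apply/ffunP => I; rewrite !ffunE.
  have -> : complexify_form (two_form S) = two_form (tc S).
    exact: (map_two_form (real_complex R) S).
  by rewrite add0r two_formZ.
exists 0, (two_form S), 1, (Tuple szt); split.
- split; [exact: homogeneous0 | exact: homogeneous_two_form | exact: oner_neq0 |].
  exact: frees.
- by rewrite eform scale1r.
- rewrite scale1r -/(wprod s).
  rewrite (_ : conj_form (wprod s) = wprod (conj_thetas cj 'i%C (tc P) (tc J))).
    rewrite -wprod_cat (_ : N./2 = n); last by lia.
    by rewrite -(map_two_form (real_complex R) S) in top.
  exact: (map_form_wprod (@conjc R)).
Qed.

End HasType.

(** * The closed two-form *)

Section Contraction2.
Variables (F : numFieldType) (N : nat).
Implicit Types (X Y : 'cV[F]_N) (phi : ext F N).

Lemma contract_sum_stdvec X phi :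
  contract X phi = \sum_i X i 0 *: contract (stdvec i) phi.
Proof.
rewrite [in LHS](cV_sum_stdvec X).
rewrite (big_morph (fun Z => contract Z phi) (fun Z W => contractDl Z W phi)
  (contract0l phi)).
by apply: eq_bigr => i _; rewrite contractZl.
Qed.

Lemma eval2_anti phi X Y : eval2 phi X Y = - eval2 phi Y X.
Proof. by rewrite /eval2 contract_anticomm extNE. Qed.

Lemma eval2_suml phi X Y :
  eval2 phi X Y = \sum_i X i 0 * eval2 phi (stdvec i) Y.
Proof.
rewrite /eval2 [contract X _]contract_sum_stdvec linear_sum sum_ffunE.
by apply: eq_bigr => i _; rewrite linearZ extZE.
Qed.

(** The transpose order of the indices makes form_mx phi *m X the contraction of
    phi by X. *)
Definition form_mx phi : 'M[F]_N := \matrix_(i, j) eval2 phi (stdvec j) (stdvec i).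

Lemma coval_form_mx phi X Y : coval (form_mx phi *m X) Y = eval2 phi X Y.
Proof.
rewrite eval2_suml; under [RHS]eq_bigr do rewrite eval2_anti eval2_suml.
rewrite /coval; under [LHS]eq_bigr do rewrite mxE mulr_suml.
rewrite exchange_big; apply: eq_bigr => j _; rewrite mulrN mulr_sumr -sumrN.
apply: eq_bigr => i _; rewrite mxE (eval2_anti _ (stdvec j)); ring.
Qed.

Lemma form_mx_anti phi : (form_mx phi)^T = - form_mx phi.
Proof. by apply/matrixP => i j; rewrite !mxE eval2_anti. Qed.

End Contraction2.

Section AlmostAbelianMx.
Variables (F : numFieldType) (m : nat) (A : 'M[F]_m).

Definition e0_row : 'rV[F]_(1 + m) := row_mx 1%:M 0.
Definition ad_e0 : 'M[F]_(1 + m) := block_mx 0 0 0 A.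

Lemma e0_rowE (X : 'cV[F]_(1 + m)) : (e0_row *m X) 0 0 = X 0 0.
Proof.
rewrite -{1}[X]vsubmxK /e0_row mul_row_col mul1mx mul0mx addr0 mxE.
by congr (X _ _); apply: val_inj.
Qed.

Lemma ad_e0E (X : 'cV[F]_(1 + m)) : ad_e0 *m X = col_mx 0 (A *m dsubmx X).
Proof. by rewrite -{1}[X]vsubmxK mul_block_col !mul0mx !add0r. Qed.

Lemma aa_bracketE X Y : aa_bracket A X Y = lie_br e0_row ad_e0 X Y.
Proof.
rewrite /lie_br !e0_rowE !ad_e0E !scale_col_mx opp_col_mx add_col_mx.
by rewrite !scaler0 subr0.
Qed.

Lemma ad_e0_col0 i : ad_e0 i 0 = 0.
Proof.
have -> : 0 = lshift m 0 :> 'I_(1 + m) by apply: val_inj.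
rewrite -(splitK i); case: (split i) => j /=.
  by rewrite block_mxEul mxE.
by rewrite block_mxEdl mxE.
Qed.

(** Among the basis vectors only e_0 has nonzero brackets with the later ones, so
    only the terms with e^0 survive. *)
Lemma d_dual_basis_aa i :
  d_dual_basis (aa_bracket A) i =
    - wedge (covector (stdvec 0)) (covector (ad_e0^T *m stdvec i)).
Proof.
rewrite /d_dual_basis.
have brE (j l : 'I_(1 + m)) : (j < l)%N ->
    aa_bracket A (stdvec j) (stdvec l) i 0 = (j == 0)%:R * ad_e0 i l.
  move=> jl; have nl0 : (l == 0) = false.
    by apply/negbTE; rewrite -val_eqE /= -lt0n (leq_ltn_trans _ jl).
  have col (q : 'I_(1 + m)) : (ad_e0 *m stdvec q) i 0 = ad_e0 i q.
    by rewrite /stdvec -colE mxE.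
  rewrite aa_bracketE /lie_br !e0_rowE mxE [(- _ : 'cV_ _) _ _]mxE.
  rewrite ![(_ *: _ : 'cV_ _) _ _]mxE !col !mxE !andbT ![0 == _]eq_sym nl0.
  by rewrite mul0r subr0.
rewrite (bigD1 0) //= [X in _ + X]big1 ?addr0 => [|j nj0]; last first.
  by rewrite big1 // => l jl; rewrite brE // (negPf nj0) mul0r oppr0 scale0r.
have covector_std (q : 'I_(1 + m)) : covector (stdvec q) = ext_basis F [set q].
  rewrite /covector (bigD1 q) //= mxE !eqxx scale1r big1 ?addr0 // => l nl.
  by rewrite mxE (negPf nl) scale0r.
rewrite covector_std [X in wedge _ X]/covector linear_sum -sumrN big_mkcond.
apply: eq_bigr => l _; rewrite linearZ /= ext_basis_wedge.
have -> : (ad_e0^T *m stdvec i) l 0 = ad_e0 i l.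
  by rewrite /stdvec -colE !mxE.
case: ifP => l0; last first.
  have -> : l = 0 by apply: val_inj; apply/eqP; rewrite /= -leqn0 leqNgt l0.
  by rewrite ad_e0_col0 scale0r oppr0.
rewrite brE // eqxx mul1r scaleNr disjoints1 inE eq_sym -val_eqE /= -lt0n l0 mul1r.
rewrite /shuffle_sign (_ : [set p | _] = set0) ?cards0 ?scale1r //.
apply/setP => -[a b]; rewrite !inE /=; case: eqP => //= ->.
by rewrite ltn0 andbF.
Qed.

(** This is the value of - d phi on (e_0, u, v), computed by three contractions of
    d phi; as u and v lie in the abelian ideal, the terms where e^0 survives the
    first contraction vanish at degree 0. *)
Lemma closed_form_ad phi (u v : 'cV[F]_(1 + m)) :
  ext_d (aa_bracket A) phi = 0 -> u 0 0 = 0 -> v 0 0 = 0 ->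
  eval2 phi (ad_e0 *m u) v + eval2 phi u (ad_e0 *m v) = 0.
Proof.
move=> closed u0 v0.
have := congr1 (fun f : ext F (1 + m) =>
  contract v (contract u (contract (stdvec 0) f)) set0) closed.
rewrite /= !linear0 /ext_d !linear_sum sum_ffunE [RHS]ffunE.
rewrite [eval2 phi u _]eval2_anti !(eval2_suml phi (_ *m _)) -sumrB => h.
apply: oppr_inj; rewrite oppr0 -[RHS]h -sumrN; apply: eq_bigr => i _.
rewrite d_dual_basis_aa wedgeNl !linearN -wedgeA.
set a := ad_e0^T *m _; set W := contract _ phi.
have au x : coval a x = (ad_e0 *m x) i 0 by rewrite coval_mull trmxK coval_stdvec.
have a0 : coval a (stdvec 0) = 0.
  by rewrite au /stdvec -colE mxE ad_e0_col0.
rewrite /= extNE.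
have e0v (Z : 'cV[F]_(1 + m)) chi : Z 0 0 = 0 ->
    contract Z (wedge (covector (stdvec 0)) chi) =
      - wedge (covector (stdvec 0)) (contract Z chi).
  by move=> Z0; rewrite contract_wedge_covector coval_stdvec Z0 scale0r sub0r.
have c00 : coval (stdvec 0 : 'cV[F]_(1 + m)) (stdvec 0) = 1.
  by rewrite coval_stdvec mxE !eqxx.
rewrite [contract (stdvec 0) _]contract_wedge_covector c00 scale1r.
rewrite !linearB /= (e0v u) // linearN /= opprK (e0v v) // extDE extNE.
rewrite [wedge _ _ set0]wedge_covectorE [X in _ = - (_ - X)]big_pred0 => [|q]; last first.
  by rewrite inE.
rewrite subr0 contract_wedge_covector linearB linearZ /= contract_wedge_covector.
rewrite !au !(extDE, extNE, extZE) [wedge _ _ set0]wedge_covectorE.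
rewrite [X in _ = - (_ - (_ - X))]big_pred0 => [|q]; last by rewrite inE.
by rewrite -!/(eval2 _ _ _) subr0.
Qed.

End AlmostAbelianMx.

(** The form with matrix S0, restricted to the kernel of P and extended by 0 along
    the image of P. *)
Definition cut_form (F : numFieldType) N (P S0 : 'M[F]_N) : 'M[F]_N :=
  (1%:M - P)^T *m S0 *m (1%:M - P).

Section SymplecticInverse.
Variables (R : realFieldType) (N : nat) (P J S0 : 'M[R]_N).
Hypotheses (PP : P *m P = P) (PJ : P *m J = J) (JP : J *m P = J) (JJ : J *m J = - P).
Hypothesis antiS0 : S0^T = - S0.
Hypothesis nondeg : forall X, P *m X = 0 ->
  (forall Y, P *m Y = 0 -> coval (S0 *m X) Y = 0) -> X = 0.

Local Notation Q := (1%:M - P).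

(** Adding the positive form P^T P on the image of P to S gives an invertible
    matrix M.  Its inverse, compressed to the kernel of P, inverts S there. *)
Lemma symplectic_inverse : exists be, gc_blocks P J (cut_form P S0) be.
Proof.
pose S := cut_form P S0; rewrite -/S.
have PQ : P *m Q = 0 by rewrite mulmxBr mulmx1 PP subrr.
have QP : Q *m P = 0 by rewrite mulmxBl mul1mx PP subrr.
have QQ : Q *m Q = Q by rewrite {1}mulmxBl mul1mx PQ subr0.
have QtQt : Q^T *m Q^T = Q^T by rewrite -trmx_mul QQ.
have QtPt : Q^T *m P^T = 0 by rewrite -trmx_mul PQ trmx0.
have QtS : Q^T *m S = S by rewrite /S /cut_form !mulmxA QtQt.
have SQ : S *m Q = S by rewrite /S /cut_form -!mulmxA QQ.
have antiS : S^T = - S.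
  by rewrite /S /cut_form !trmx_mul trmxK antiS0 mulNmx mulmxN mulmxA.
pose M := S + P^T *m P.
have MQ : M *m Q = S by rewrite mulmxDl SQ -mulmxA PQ mulmx0 addr0.
have QtM : Q^T *m M = S by rewrite mulmxDr QtS mulmxA QtPt mul0mx addr0.
have kerM (X : 'cV[R]_N) : M *m X = 0 -> X = 0.
  move=> MX; have SX : S *m X = 0 by rewrite -QtM -mulmxA MX mulmx0.
  have QX : Q *m X = 0.
    apply: nondeg => [|Y PY]; first by rewrite mulmxA PQ mul0mx.
    have {1}-> : Y = Q *m Y by rewrite mulmxBl mul1mx PY subr0.
    by rewrite -[Q]trmxK -coval_mull trmxK !mulmxA SX coval0l.
  have : M *m X = P^T *m (P *m X) by rewrite mulmxDl SX add0r -mulmxA.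
  rewrite MX => /esym/(congr1 (coval X)); rewrite coval0r.
  rewrite covalC coval_mull trmxK => nrm.
  have PX : P *m X = 0.
    apply/matrixP => i j; rewrite ord1 [RHS]mxE; apply/eqP; rewrite -sqrf_eq0.
    have := nrm; rewrite /coval => /eqP; rewrite psumr_eq0 => [/allP/(_ i)|l _].
      by rewrite mem_index_enum expr2 => /(_ isT).
    by rewrite -expr2 sqr_ge0.
  by rewrite -[X]mul1mx -[1%:M](subrK P) mulmxDl QX PX addr0.
have uM : M \in unitmx.
  rewrite -unitmx_tr -row_free_unit -kermx_eq0 -submx0; apply/rV_subP => v.
  move=> /sub_kermxP/(congr1 trmx); rewrite trmx_mul trmxK trmx0 => /kerM v0.
  by rewrite -[v]trmxK v0 trmx0 sub0mx.
have VS : invmx M *m S = Q by rewrite -MQ mulKmx.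
have SV : S *m invmx M = Q^T by rewrite -QtM mulmxK.
pose be := - (Q *m invmx M *m Q^T).
have beS : be *m S = - Q by rewrite mulNmx -!mulmxA QtS VS QQ.
have Sbe : S *m be = - Q^T by rewrite mulmxN !mulmxA SQ SV QtQt.
have Qbe : Q *m be = be by rewrite mulmxN !mulmxA QQ.
have beQt : be *m Q^T = be by rewrite mulNmx -!mulmxA QtQt mulmxA.
have Sbet : S *m be^T = Q^T.
  by rewrite -[S]opprK -antiS mulNmx -trmx_mul beS linearN opprK.
exists be; split => //.
(* be is antisymmetric because be S be^T can be computed in two ways. *)
- have <- : Q *m be^T = be^T by rewrite -[in RHS]beQt trmx_mul trmxK.
  have -> : Q = - (be *m S) by rewrite beS opprK.
  by rewrite mulNmx -mulmxA Sbet beQt.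
- by rewrite -SQ -mulmxA QP mulmx0.
- by rewrite -Qbe mulmxA PQ mul0mx.
- by rewrite beS opprB.
- by rewrite Sbe linearB /= trmx1 opprB.
Qed.

End SymplecticInverse.

(** The complementary projection 1 - P maps into the abelian ideal and commutes
    with ad e_0, so that closed_form_ad applies to its values. *)
Lemma cut_form_invariant (F : numFieldType) m (A : 'M[F]_m) (phi : ext F (1 + m)) P :
  ext_d (aa_bracket A) phi = 0 ->
  e0_row F m *m P = e0_row F m -> ad_e0 A *m P = P *m ad_e0 A ->
  cut_form P (form_mx phi) *m ad_e0 A = - ((ad_e0 A)^T *m cut_form P (form_mx phi)).
Proof.
move=> closed eP DP; set D := ad_e0 A; set S := cut_form _ _.
pose Q := 1%:M - P.
have SE Z Y : coval (S *m Z) Y = eval2 phi (Q *m Z) (Q *m Y).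
  by rewrite -coval_form_mx -[X in coval X Y]mulmxA -mulmxA coval_mull trmxK.
have DQ : D *m Q = Q *m D by rewrite mulmxBr mulmxBl mulmx1 mul1mx DP.
have Q0 (Z : 'cV[F]_(1 + m)) : (Q *m Z) 0 0 = 0.
  by rewrite -e0_rowE mulmxA mulmxBr mulmx1 eP subrr mul0mx mxE.
clearbody S; apply: eq_mulmx_cV => X; apply: coval_inj => Y.
have := closed_form_ad closed (Q0 X) (Q0 Y).
rewrite !(mulmxA (ad_e0 A)) -/D DQ -!(mulmxA Q) -!SE => /eqP.
rewrite addr_eq0 => /eqP h.
by rewrite -mulmxA h mulNmx covalNl -mulmxA (coval_mull D^T) trmxK.
Qed.

(** * The complex structure on a complement of the ideal *)

Lemma mx_of_linear (F : fieldType) p q (g : {linear 'cV[F]_p -> 'cV[F]_q}) :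
  exists M : 'M[F]_(q, p), forall v, M *m v = g v.
Proof.
exists (\matrix_(i, j) g (delta_mx j 0) i 0) => v.
rewrite [v in RHS](matrix_sum_delta v).
rewrite linear_sum /=; apply/matrixP => i j; rewrite ord1 mxE summxE.
apply: eq_bigr => l _; by rewrite big_ord1 linearZ !mxE mulrC.
Qed.

Section QuotientLift.
Local Open Scope quotient_scope.
Variables (F : numFieldType) (N : nat) (U : {vspace 'cV[F]_N}) (P : 'M[F]_N).
Hypothesis kerP : forall v, (v \in U) = (P *m v == 0).
Hypothesis PP : P *m P = P.

(** The linear section of the quotient map with values in the image of P; it does
    not depend on the choice of representatives because P kills U. *)
Definition quot_lift (x : vquot U) : 'cV[F]_N := P *m repr x.

Lemma quot_lift_pi y : quot_lift (\pi y) = P *m y.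
Proof.
have := vquot_reprK U y; rewrite kerP mulmxBr subr_eq0 => /eqP h.
by rewrite /quot_lift -h.
Qed.

Lemma pi_quot_lift x : \pi_(vquot U) (quot_lift x) = x.
Proof.
rewrite -[RHS]reprK; apply/eqP; rewrite vquot_eqE kerP /quot_lift.
by rewrite mulmxBr mulmxA PP subrr.
Qed.

Lemma pi_proj y : \pi_(vquot U) (P *m y) = \pi y.
Proof. by apply/eqP; rewrite vquot_eqE kerP mulmxBr mulmxA PP subrr. Qed.

Lemma quot_lift_is_linear : linear quot_lift.
Proof.
move=> c x y; have [[u ->] [v ->]] := (vquot_surj x, vquot_surj y).
have -> : c *: \pi_(vquot U) u + \pi_(vquot U) v = \pi_(vquot U) (c *: u + v).
  by rewrite vquot_piD vquot_piZ.
by rewrite !quot_lift_pi mulmxDr -scalemxAr.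
Qed.

HB.instance Definition _ := GRing.isLinear.Build F (vquot U) 'cV[F]_N *:%R
  quot_lift quot_lift_is_linear.

Lemma pi_is_linear : linear (fun y : 'cV[F]_N => \pi_(vquot U) y).
Proof. by move=> c x y; rewrite vquot_piD vquot_piZ. Qed.

Definition quot_pi (y : 'cV[F]_N) := \pi_(vquot U) y.

HB.instance Definition _ := GRing.isLinear.Build F 'cV[F]_N (vquot U) *:%R
  quot_pi pi_is_linear.

Variables (e : 'rV[F]_N) (D : 'M[F]_N).
Hypotheses (eP : e *m P = e) (DP : D *m P = P *m D).
Variable br : 'cV[F]_N -> 'cV[F]_N -> 'cV[F]_N.
Hypothesis brE : br =2 lie_br e D.
Hypothesis pi_br : forall X Y,
  \pi_(vquot U) (br X Y) = vquot_bracket U br (\pi X) (\pi Y).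

(** The Nijenhuis tensor of the lift is fixed by P, as P is a morphism of Lie
    algebras, and it lies in U = ker P, as its class is the Nijenhuis tensor of the
    quotient. *)
Lemma complex_structure_lift (J : {linear vquot U -> vquot U}) :
  is_complex_structure (vquot_bracket U br) J ->
  exists Jm : 'M[F]_N, [/\ P *m Jm = Jm, Jm *m P = Jm, Jm *m Jm = - P
    & forall X Y, nijenhuis P Jm e D X Y = 0].
Proof.
case=> JJ nijenhuisJ; have [Jm JmE] := mx_of_linear (quot_lift \o J \o quot_pi).
have PJ : P *m Jm = Jm.
  by apply: eq_mulmx_cV => v; rewrite -mulmxA JmE /= /quot_lift mulmxA PP.
have JP : Jm *m P = Jm.
  by apply: eq_mulmx_cV => v; rewrite -mulmxA !JmE /= /quot_pi pi_proj.
have piJ v : \pi_(vquot U) (Jm *m v) = J (\pi v).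
  by rewrite JmE /= pi_quot_lift.
have piD u v : \pi_(vquot U) (u - v) = \pi u - \pi v := linearB quot_pi u v.
exists Jm; split=> //.
  apply: eq_mulmx_cV => v; rewrite -mulmxA JmE /= /quot_pi piJ JJ linearN /= quot_lift_pi.
  by rewrite mulNmx.
move=> X Y.
have PN : P *m nijenhuis P Jm e D X Y = nijenhuis P Jm e D X Y.
  have := lie_br_proj eP DP (Jm *m X) (Jm *m Y); rewrite !(mulmxA P) PJ /nijenhuis.
  do 4 move: (lie_br e D _ _) => ?; move=> Pb.
  by rewrite !mulmxBr -Pb !mulmxA PP PJ.
rewrite -PN; apply/eqP; rewrite -kerP -[nijenhuis _ _ _ _ _ _]subr0 -vquot_eqE; apply/eqP.
rewrite /nijenhuis -!brE !piD pi_proj !piJ !pi_br !piJ.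
by rewrite nijenhuisJ; apply/esym/(linear0 quot_pi).
Qed.

End QuotientLift.

(** The transposes of a basis of the row space of M^T form a basis of U. *)
Lemma rank_of_projection (F : fieldType) p (U : {vspace 'cV[F]_p}) (M : 'M[F]_p) :
  (forall v, M *m v \in U) -> (forall v, v \in U -> M *m v = v) ->
  \rank M = \dim U.
Proof.
move=> MU fixU; have <- : <<row_seq (row_base M^T)>>%VS = U.
  apply/vspaceP => v; rewrite span_row_seq eq_row_base.
  apply/submxP/idP => [[c /(congr1 trmx)]|/fixU <-].
    by rewrite trmxK trmx_mul trmxK => ->.
  by exists v^T; rewrite trmx_mul.
have /eqP -> := free_row_seq (row_base_free M^T).
by rewrite size_row_seq mxrank_tr.
Qed.

Section Decomposition.
Variables (F : numFieldType) (m : nat) (A : 'M[F]_m) (hc hs : {vspace 'cV[F]_m}).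
Hypotheses (Ahc : forall v, v \in hc -> A *m v \in hc)
           (Ahs : forall v, v \in hs -> A *m v \in hs).
Hypotheses (hcs : (hc + hs)%VS = fullv) (hcs0 : (hc :&: hs)%VS = 0%VS).

(** The projection of the ideal onto hc along hs, extended by the identity on e_0.
    It commutes with ad e_0 because both hc and hs are invariant. *)
Lemma projection_along_ideal : exists P : 'M[F]_(1 + m),
  [/\ P *m P = P, forall X, (X \in aa_ideal hs) = (P *m X == 0),
      e0_row F m *m P = e0_row F m, ad_e0 A *m P = P *m ad_e0 A
    & \rank P = (\dim hc).+1].
Proof.
have [Pc PcE] := mx_of_linear (fun_of_lfun (daddv_pi hc hs)).
have hsc0 : (hs :&: hc)%VS = 0%VS by rewrite capvC.
have Pc_hc v : Pc *m v \in hc by rewrite PcE memv_pi.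
have Pc_id v : v \in hc -> Pc *m v = v by move=> h; rewrite PcE /= daddv_pi_id.
have Pc_add v : Pc *m v + daddv_pi hs hc v = v.
  by rewrite PcE /= daddv_pi_add // hcs memvf.
have kerPc v : (v \in hs) = (Pc *m v == 0).
  apply/idP/eqP => [h|h].
    move: (Pc_add v); rewrite (daddv_pi_id hsc0 h) => /(canRL (addrK _)) ->.
    by rewrite subrr.
  by rewrite -(Pc_add v) h add0r memv_pi.
have PcPc : Pc *m Pc = Pc by apply: eq_mulmx_cV => v; rewrite -mulmxA Pc_id.
have APc : A *m Pc = Pc *m A.
  apply: eq_mulmx_cV => v; rewrite -!mulmxA -[in RHS](Pc_add v) mulmxDr mulmxDr.
  rewrite [Pc *m (A *m (Pc *m v))]Pc_id ?Ahc //.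
  by have /Ahs := memv_pi hs hc v; rewrite kerPc => /eqP ->; rewrite addr0.
exists (block_mx 1%:M 0 0 Pc); split.
- by rewrite mulmx_block !mulmx0 !mul0mx !addr0 !add0r mul1mx PcPc.
- move=> X; apply/aa_idealP/eqP => [[v vhs ->]|].
    rewrite mul_block_col !mul0mx mulmx0 !add0r.
    by move: vhs; rewrite kerPc => /eqP ->; rewrite col_mx0.
  rewrite -{1}[X]vsubmxK mul_block_col !mul0mx addr0 add0r mul1mx -[RHS]col_mx0.
  move/eq_col_mx => [X0 PX]; exists (dsubmx X); first by rewrite kerPc PX.
  by rewrite -{1}[X]vsubmxK X0.
- by rewrite /e0_row mul_row_block !mul0mx mulmx0 mul1mx !addr0.
- by rewrite /ad_e0 !mulmx_block !mulmx0 !mul0mx !addr0 !add0r APc.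
- rewrite rank_diag_block_mx mxrank1 add1n; congr _.+1.
  exact: rank_of_projection.
Qed.

End Decomposition.

(** * Complexification of the bracket, and the theorem *)

Section Complexify.
Variables (R : realType) (N : nat).
Local Notation tc := (@to_complex R _ _).

Lemma to_complexD p q (M M' : 'M[R]_(p, q)) : tc (M + M') = tc M + tc M'.
Proof. exact: map_mxD. Qed.

Lemma to_complexN p q (M : 'M[R]_(p, q)) : tc (- M) = - tc M.
Proof. exact: map_mxN. Qed.

Lemma complex_mx_ReIm p q (X : 'M[R[i]]_(p, q)) :
  X = tc (map_mx (@complex.Re R) X) + 'i%C *: tc (map_mx (@complex.Im R) X).
Proof.
by apply/matrixP => i j; rewrite !mxE; case: (X i j) => a b; simpc.
Qed.

Lemma complexify_lie_br br (e : 'rV[R]_N) (D : 'M[R]_N) :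
  br =2 lie_br e D ->
  complexify_bracket br =2 lie_br (tc e) (tc D).
Proof.
move=> brE X Y; rewrite [in RHS](complex_mx_ReIm X) [in RHS](complex_mx_ReIm Y).
rewrite /complexify_bracket !brE.
rewrite lie_brDl lie_brZl !lie_brDr !lie_brZr !(map_lie_br (real_complex R)).
do 4 move: (lie_br e D _ _) => ?.
rewrite [X in _ = _ + X]scalerDr scalerA -expr2 sqr_i scaleN1r.
by rewrite !to_complexD scalerDr to_complexN addrACA [- _ + _]addrC.
Qed.

End Complexify.

Lemma eq_courant (F : fieldType) N (br br' : 'cV[F]_N -> 'cV[F]_N -> 'cV[F]_N) :
  br =2 br' -> courant br =2 courant br'.
Proof.
move=> e u v; rewrite /courant e; congr (col_mx _ (_ - _));
  by apply/matrixP => i j; rewrite !mxE; congr (- _); apply: eq_bigr => l _; rewrite e.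
Qed.

Theorem theorem3 (R : realType) (n k : nat) (A : 'M[R]_(2 * n - 1))
    (hc hs : {vspace 'cV[R]_(2 * n - 1)}) :
  (1 <= k <= n)%N ->
  (forall v, v \in hc -> A *m v \in hc) ->
  (forall v, v \in hs -> A *m v \in hs) ->
  (hc + hs)%VS = fullv ->
  (hc :&: hs)%VS = 0%VS ->
  \dim hc = (2 * k - 1)%N ->
  \dim hs = (2 * (n - k))%N ->
  (exists J : {linear vquot (aa_ideal hs) -> vquot (aa_ideal hs)},
    is_complex_structure (vquot_bracket (aa_ideal hs) (aa_bracket A)) J) ->
  (exists omega : ext R (1 + (2 * n - 1)),
    closed_2form (aa_bracket A) omega /\
    nondegenerate_on omega (aa_ideal hs)) ->
  exists J : 'M[R]_((1 + (2 * n - 1)) + (1 + (2 * n - 1))),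
    is_generalized_complex (aa_bracket A) J /\ has_type J k.
Proof.
move=> /andP[k_gt0 le_kn] Ahc Ahs hcs hcs0 dim_hc dim_hs [J0 J0cplx].
move=> [omega [[_ closed] nondeg]].
have [P [PP kerP eP DP rankP]] := projection_along_ideal Ahc Ahs hcs hcs0.
have [J [PJ JP JJ nijenhuis0]] := complex_structure_lift kerP PP eP DP (aa_bracketE A)
  (pi_aa_bracket Ahs) J0cplx.
have [be H] : exists be, gc_blocks P J (cut_form P (form_mx omega)) be.
  apply: symplectic_inverse => //; first exact: form_mx_anti.
  move=> X PX0 nX; apply: nondeg => [|Y]; first by rewrite kerP PX0.
  by rewrite kerP => /eqP/nX; rewrite coval_form_mx.
set S := cut_form _ _ in H.
exists (gc_mx J S be); split; last first.
  apply: (has_type_gc_mx (n := n) H) => //; first by rewrite rankP dim_hc; lia.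
  lia.
split; [exact: gc_mx_sqr H | exact: gc_mx_orthogonal H |] => u v.
have brC : complexify_bracket (aa_bracket A) =2
    lie_br (to_complex (e0_row R _)) (to_complex (ad_e0 A)).
  exact: complexify_lie_br (aa_bracketE A).
rewrite !inE (eq_courant brC) /to_complex gc_mx_map => /eqP uL /eqP vL; apply/eqP.
apply: (courant_eigenspace (gc_blocks_map (real_complex R) H)) uL vL.
- by rewrite -expr2 sqr_i.
- by rewrite -map_mxM eP.
- by rewrite -!map_mxM DP.
- by rewrite map_trmx -!map_mxM -map_mxN; congr map_mx; apply: cut_form_invariant.
- exact: nijenhuis_map.
Qed.
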